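(* Let $\mathcal T_h$ be a conforming triangular mesh of a bounded Lipschitz domain $\Omega\subset\mathbb R^2$, and let $p$ be an even positive integer. Let $$\widetilde V_n^{\rm im}=\Big\{v\in H^1(\mathcal T_h,\Omega)\ \Big|\ v_{|K}\in\mathbb P_p(K)\ \forall K\in\mathcal T_h,\quad([\![v]\!],L_j^F)_{0,F}=0\ \ \forall j\in\{0,\dots,p-2,p\},\ \forall F\in\mathcal F_h^I\Big\}$$ and $$\widetilde V_n^{\rm ex}=\operatorname{span}\Big(b_{p-1}^F\text{ and }\{\varphi_j^F\}_{j=1}^{p-1}\ \ \forall F\in\mathcal F_h;\quad\{\varphi_\ell^K\}_{\ell=1}^{(p-1)(p-2)/2}\ \ \forall K\in\mathcal T_h\Big),$$ with the functions $b_{p-1}^F$, $\varphi_j^F$, $\varphi_\ell^K$ defined in the context. Then $\widetilde V_n^{\rm im}=\widetilde V_n^{\rm ex}$.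
   Context: $\mathcal F_h$ is the set of edges of $\mathcal T_h$ and $\mathcal F_h^I$ the subset of internal edges; $\omega_F$ is the union of the (one or two) elements having $F$ as an edge. $H^1(\mathcal T_h,\Omega)$ is the space of $L^2(\Omega)$ functions whose restriction to each $K\in\mathcal T_h$ is in $H^1(K)$. $\mathbb P_p(K)$ is the space of polynomials of degree at most $p$ on $K$. $(\cdot,\cdot)_{0,F}$ is the $L^2(F)$ inner product. On an internal edge $F=\partial K_1\cap\partial K_2$ with fixed unit normal $\mathbf n_F$, and $\mathbf n_{K_i}$ the outward unit normal of $K_i$, $[\![v]\!]=v_{|K_1}(\mathbf n_{K_1}\cdot\mathbf n_F)+v_{|K_2}(\mathbf n_{K_2}\cdot\mathbf n_F)$ (traces on $F$). $L_j$ is the Legendre polynomial of degree $j$ on $[-1,1]$, and $L_j^F$ is $L_j$ mapped affinely to the edge $F$. For a triangle $K$ with edges $F_1,F_2,F_3$, $\lambda_i=\lambda_{K,F_i}$ is the barycentric coordinate associated with the vertex opposite to $F_i$ (zero on $F_i$). Nonconforming edge bubble of degree $p-1$: $b_{p-1}^F=L_{p-1}(1-2\lambda_{K,F})$ on each element $K\subset\omega_F$, and $0$ on all other elements. Edge modal functions: for $F$ with endpoints $\nu_a,\nu_b$ (ordered once and for all) and $1\le j\le p-1$, on each $K\subset\omega_F$, $\varphi_j^F=\frac{8\sqrt{4j+2}}{j(j+1)}\lambda_a\lambda_bL_j'(\lambda_b-\lambda_a)$, where $\lambda_a,\lambda_b$ are the barycentric coordinates of $K$ equal to $1$ at $\nu_a,\nu_b$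 respectively; $\varphi_j^F=0$ on all other elements. Elemental modal functions: for $K\in\mathcal T_h$ and integers $r_1,r_2\ge0$ with $r_1+r_2\le p-3$, the function $\lambda_1\lambda_2\lambda_3L_{r_1}(\lambda_2-\lambda_1)L_{r_2}(2\lambda_3-1)$ on $K$, $0$ elsewhere; these are enumerated as $\varphi_\ell^K$, $\ell=1,\dots,(p-1)(p-2)/2$ (none if $p=2$). *)

(* Defs.v *)
From HB Require Import structures.
From mathcomp Require Import all_boot all_order all_algebra.
From mathcomp Require Import all_classical all_reals all_analysis.

Set Implicit Arguments.
Unset Strict Implicit.
Unset Printing Implicit Defensive.

Import Order.TTheory GRing.Theory Num.Theory.
Import numFieldNormedType.Exports.

Local Open Scope classical_set_scope.
Local Open Scope ring_scope.

(* The plane is the normed space [R * R] of the library. Its norm is the sup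
   norm, which is only used through the topology; Euclidean lengths and angles
   go through [dot]. *)

Section Plane.
Context {R : realType}.
Implicit Types x y e : R * R.

Definition dot x y : R := x.1 * y.1 + x.2 * y.2.
Definition cross x y : R := x.1 * y.2 - x.2 * y.1.
Definition enorm x : R := Num.sqrt (dot x x).

Definition area_measure :
    set (measurableTypeR R * measurableTypeR R) -> \bar R :=
  (lebesgue_measure \x lebesgue_measure)%E.

Definition topological_boundary (A : set (R * R)) : set (R * R) :=
  closure A `\` A°.

(* Near each boundary point x there are Cartesian coordinates (s, t), centred
   at x with axes e and its rotation by a right angle, in which the set is the
   part of the box |s| < r, |t| < h lying below a Lipschitz graph, and its
   boundary is the graph. *)
Definition lipschitz_boundary (Omega : set (R * R)) :=
  forall x, topological_boundary Omega x ->
  exists (e : R * R) (gamma : R -> R) (k r h : R),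
    [/\ dot e e = 1, 0 < r, 0 < h, k.-lipschitz gamma &
        (forall s, `|s| < r -> `|gamma s| <= h / 2) /\
        forall s t, `|s| < r -> `|t| < h ->
          let y := x + s *: e + t *: (- e.2, e.1) in
          (Omega y <-> t < gamma s) /\
          (topological_boundary Omega y <-> t = gamma s)].

Definition bounded_lipschitz_domain (Omega : set (R * R)) :=
  [/\ open Omega, connected Omega, Omega !=set0, bounded_set Omega &
      lipschitz_boundary Omega].

End Plane.

Section FunctionSpaces.
Context {R : realType}.
Implicit Types (D : set (R * R)) (u v g phi : R * R -> R).

(* Elements of L^2(D) are represented by functions on the whole plane whose
   values off D are irrelevant. *)
Definition L2 D v := v \_ D \in Lfun area_measure 2%:E.

(* [iter_derive phi [:: e1; ...; en]] = D_e1 (... (D_en phi)) *)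
Definition iter_derive phi (s : seq (R * R)) : R * R -> R :=
  foldr (fun e f x => 'D_e f x) phi s.

Definition smooth phi :=
  forall s, continuous (iter_derive phi s) /\
            forall x e, derivable (iter_derive phi s) x e.

Definition test_function D phi :=
  smooth phi /\
  exists C : set (R * R),
    [/\ compact C, C `<=` D & forall x, ~ C x -> phi x = 0].

Definition weak_derivative D (e : R * R) u g :=
  forall phi, test_function D phi ->
    \int[area_measure]_(x in D) (u x * 'D_e phi x) =
    - \int[area_measure]_(x in D) (g x * phi x).

Definition H1 D u :=
  L2 D u /\
  exists g1 g2, [/\ L2 D g1, L2 D g2,
    weak_derivative D (1, 0) u g1 & weak_derivative D (0, 1) u g2].

Definition poly_fun (p : nat) (q : R * R -> R) :=
  exists c : nat -> nat -> R, forall x,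
    q x = \sum_(i < p.+1) \sum_(j < p.+1 | (i + j <= p)%N)
            c i j * x.1 ^+ i * x.2 ^+ j.

(* u|_D belongs to P_p(D), as an almost-everywhere class *)
Definition poly_on (p : nat) D u :=
  exists q, poly_fun p q /\ ae_eq area_measure D u q.

(* The representative of u|_D that is continuous on D, when there is one (on a
   triangle its values on D are then determined by u). Its restriction to an
   edge is the trace of u|_D for every u in H^1(D) with a representative
   continuous up to the boundary, in particular if u|_D is polynomial. *)
Definition continuous_rep D u : R * R -> R :=
  get [set w : R * R -> R | {within D, continuous w} /\
                            ae_eq area_measure D u w].

Definition linear_span (S : set (R * R -> R)) : set (R * R -> R) :=
  [set w | exists (n : nat) (c : 'I_n -> R) (f : 'I_n -> (R * R -> R)),
    (forall i, S (f i)) /\ forall x, w x = \sum_(i < n) c i * f i x].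

(* Rodrigues' formula *)
Definition legendre (n : nat) : {poly R} :=
  (2 ^+ n * n`!%:R)^-1 *: (('X ^+ 2 - 1) ^+ n)^`(n).

End FunctionSpaces.

Record mesh (R : realType) := Mesh {
  node : finType;
  elt : finType;
  pos : node -> R * R;
  vtx : elt -> 'I_3 -> node
}.

Section Mesh.
Context {R : realType} {T : mesh R}.
Implicit Types (K : elt T) (F A : {set node T}) (n : node T) (i j : 'I_3).

(* closed convex hull of the vertices in A *)
Definition hull A : set (R * R) :=
  [set x | exists w : node T -> R,
    [/\ forall n, 0 <= w n, \sum_(n in A) w n = 1 &
        x = \sum_(n in A) w n *: pos n]].

Definition triangle K := hull [set vtx K i | i : 'I_3]%SET.

(* An edge is represented by the pair of its endpoints; [edge K i] is the edge
   of K opposite to its i-th vertex. *)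
Definition edge K i : {set node T} := [set vtx K j | j : 'I_3 & j != i]%SET.
Definition edges K : {set {set node T}} := [set edge K i | i : 'I_3]%SET.
Definition mesh_edges : {set {set node T}} := (\bigcup_K edges K)%SET.
Definition internal_edges : {set {set node T}} :=
  [set F in mesh_edges | (1 < #|[set K | F \in edges K]|)%N]%SET.

(* i + 1 and i + 2 are computed modulo 3 in ['I_3]. *)
Definition bary K i (x : R * R) : R :=
  let a := pos (vtx K i) in
  let b := pos (vtx K (i + 1)) in
  let c := pos (vtx K (i + 2)) in
  cross (b - x) (c - x) / cross (b - a) (c - a).

Definition bary_node K n x : R :=
  if [pick i | vtx K i == n] is Some i then bary K i x else 0.

Definition bary_edge K F x : R :=
  if [pick i | edge K i == F] is Some i then bary K i x else 0.

Definition outward_normal K F : R * R :=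
  if [pick i | edge K i == F] is Some i then
    let a := pos (vtx K (i + 1)) in
    let b := pos (vtx K (i + 2)) in
    let n := (enorm (b - a))^-1 *: ((b - a).2, - (b - a).1) in
    if dot n (pos (vtx K i) - a) < 0 then n else - n
  else 0.

Record conforming_mesh (Omega : set (R * R)) : Prop := {
  mesh_pos_inj : injective (@pos R T);
  mesh_nondegenerate : forall K,
    cross (pos (vtx K 1) - pos (vtx K 0)) (pos (vtx K 2) - pos (vtx K 0)) != 0;
  mesh_cover : closure Omega = \bigcup_K triangle K;
  mesh_conforming : forall K1 K2, K1 <> K2 ->
    [\/ triangle K1 `&` triangle K2 = set0,
        exists i j, vtx K1 i = vtx K2 j /\
          triangle K1 `&` triangle K2 = [set pos (vtx K1 i)] |
        exists F, [/\ F \in edges K1, F \in edges K2 &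
          triangle K1 `&` triangle K2 = hull F]]
}.

Definition edge_orientation (ends : {set node T} -> node T * node T) :=
  forall F, F \in mesh_edges -> F = [set (ends F).1; (ends F).2]%SET.

Definition unit_edge_normals (nF : {set node T} -> R * R) :=
  forall F, F \in internal_edges ->
    dot (nF F) (nF F) = 1 /\
    forall m n, m \in F -> n \in F -> dot (nF F) (pos m - pos n) = 0.

Definition broken_H1 (Omega : set (R * R)) (v : R * R -> R) :=
  L2 Omega v /\ forall K, H1 (triangle K)° v.

(* only meaningful on the edge F shared by K1 and K2 *)
Definition jump (nF : {set node T} -> R * R) F K1 K2 v (x : R * R) : R :=
  continuous_rep (triangle K1) v x * dot (outward_normal K1 F) (nF F) +
  continuous_rep (triangle K2) v x * dot (outward_normal K2 F) (nF F).

(* the function equal to f K in the interior of each element K; its values on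
   the edges, a null set, are irrelevant *)
Definition elementwise (f : elt T -> R * R -> R) (x : R * R) : R :=
  \sum_K \1_((triangle K)°) x * f K x.

Section Oriented.
Variable ends : {set node T} -> node T * node T.

Definition edge_inner F (f g : R * R -> R) : R :=
  let a := pos (ends F).1 in
  let b := pos (ends F).2 in
  enorm (b - a) * \int[@lebesgue_measure R]_(t in `[0, 1])
    (f (a + t *: (b - a)) * g (a + t *: (b - a))).

(* maps the endpoints of F to -1 and 1 *)
Definition edge_legendre (j : nat) F (x : R * R) : R :=
  let a := pos (ends F).1 in
  let b := pos (ends F).2 in
  (legendre j).[2 * (dot (x - a) (b - a) / dot (b - a) (b - a)) - 1].

Definition edge_modal (j : nat) F : R * R -> R :=
  elementwise (fun K x =>
    if F \in edges K then
      let la := bary_node K (ends F).1 x in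
      let lb := bary_node K (ends F).2 x in
      8 * Num.sqrt (4 * j + 2)%:R / (j * (j + 1))%:R *
        la * lb * ((legendre j)^`()).[lb - la]
    else 0).

End Oriented.

(* nonconforming edge bubble of degree d *)
Definition edge_bubble (d : nat) F : R * R -> R :=
  elementwise (fun K x =>
    if F \in edges K then (legendre d).[1 - 2 * bary_edge K F x] else 0).

Definition elt_modal (r1 r2 : nat) K : R * R -> R :=
  elementwise (fun K' x =>
    if K' == K then
      let l1 := bary K 0 x in
      let l2 := bary K 1 x in
      let l3 := bary K 2 x in
      l1 * l2 * l3 * (legendre r1).[l2 - l1] * (legendre r2).[2 * l3 - 1]
    else 0).

End Mesh.

(* The two spaces, as subspaces of L^2(Omega): each is the set of all functions
   that represent an element of the space. *)

Definition V_im (R : realType) (Omega : set (R * R)) (T : mesh R)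
    (ends : {set node T} -> node T * node T) (nF : {set node T} -> R * R)
    (p : nat) : set (R * R -> R) :=
  [set v | [/\ @broken_H1 R T Omega v,
    forall K : elt T, poly_on p (triangle K) v &
    forall F, F \in internal_edges ->
    forall K1 K2 : elt T, K1 <> K2 -> F \in edges K1 -> F \in edges K2 ->
    forall j : nat, (j <= p - 2)%N || (j == p) ->
      edge_inner ends F (jump nF F K1 K2 v) (edge_legendre ends j F) = 0]].

(* The index condition r1 + r2 <= p - 3 on the elemental functions is written
   without subtraction, so that there are none for p = 2. *)
Definition V_ex_generators (R : realType) (T : mesh R)
    (ends : {set node T} -> node T * node T) (p : nat) : set (R * R -> R) :=
  [set f | exists2 F : {set node T}, F \in mesh_edges & f = edge_bubble (p - 1) F]
  `|` [set f | exists2 F : {set node T}, F \in mesh_edges &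
        exists2 j : nat, (1 <= j <= p - 1)%N & f = edge_modal ends j F]
  `|` [set f | exists (K : elt T) (r1 r2 : nat),
        (r1 + r2 + 3 <= p)%N /\ f = elt_modal r1 r2 K].

Definition V_ex (R : realType) (Omega : set (R * R)) (T : mesh R)
    (ends : {set node T} -> node T * node T) (p : nat) : set (R * R -> R) :=
  [set v | L2 Omega v /\
    exists2 w, linear_span (V_ex_generators ends p) w &
      ae_eq area_measure Omega v w].

(* Main.v *)
Require Import Defs.
From mathcomp Require Import all_boot all_order all_algebra.
From mathcomp Require Import all_classical all_reals all_analysis.
From mathcomp Require Import measurable_realfun.
From mathcomp Require Import ring lra zify.

Set Implicit Arguments.
Unset Strict Implicit.
Unset Printing Implicit Defensive.

Import Order.TTheory GRing.Theory Num.Theory.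
Import numFieldNormedType.Exports.

Local Open Scope classical_set_scope.
Local Open Scope ring_scope.

(** A function of either space is, on each element, a polynomial of degree at
    most [p], and a polynomial has a trace on every edge. Since the Legendre
    polynomials are an orthogonal basis, the moment conditions say exactly that
    the jump across an internal edge is a multiple of the one Legendre
    polynomial they leave free, of degree [p - 1]. Both spaces are therefore
    compared with the families of polynomials, one per element, whose jumps are
    of that form ([nonconforming_family]).

    The explicit functions are such families. The modal functions have no jump,
    and the bubble of an edge is 1 on that edge and plus or minus the free
    polynomial on the two other edges of each of its elements
    ([span_nonconforming]).

    Conversely ([nonconforming_span]), [p] being even, the free polynomial is
    odd and takes the values -1 and 1 at the ends of an edge. Hence the mean of
    the two end values of a trace is the same from both sides; it is the
    coefficient of the bubble. On an element with vertex values [v_i], the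
    bubbles then take at the vertex [i] the value
    [c_j + c_k - c_i = v_i], where [c_i] is the mean of [v_j] and [v_k]. What
    remains vanishes at the vertices, so its jumps, being multiples of a
    polynomial equal to 1 at an end, are zero; on each edge it is a combination
    of edge modal functions ([edge_expansion]), with common coefficients on both
    sides. After subtracting these, the remainder vanishes on the edges of each
    element, is divisible by the three barycentric coordinates ([bary_factor3])
    and is a combination of elemental functions
    ([plane_poly_legendre_ind]).

    The analysis consists in passing from classes of functions to polynomials.
    The trace of a polynomial class is the trace of the polynomial, as nonempty
    open sets are not negligible ([continuous_rep_triangle]); the two outward
    normals on an internal edge are opposite, as conforming triangles lie on
    opposite sides of a common edge ([opposite_sides]); and a polynomial class is
    in [H1] by integration by parts on slices ([H1_of_poly]). Open triangles lie
    in the domain because a Lipschitz domain is the interior of its closure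
    ([interior_closure_lipschitz]). *)

(** * Legendre polynomials and their moments *)

Section Univariate.
Context {R : realType}.
Implicit Types P Q A B r : {poly R}.

Lemma poly_eq0_on01 P : (forall t, 0 < t < 1 -> P.[t] = 0) -> P = 0.
Proof.
move=> P0.
pose s := [seq (i.+2%:R : R)^-1 | i <- iota 0 (size P)].
apply: (@roots_geq_poly_eq0 _ P s).
- apply/allP => _ /mapP[i _ ->]; apply/rootP; apply: P0.
  by rewrite invr_gt0 ltr0n /= invf_lt1 ?ltr0n // ltr1n.
- rewrite map_inj_uniq ?iota_uniq // => i j /invr_inj /eqP.
  by rewrite eqr_nat => /eqP [].
- by rewrite size_map size_iota.
Qed.

(** The leading coefficients are removed one after the other. *)
Lemma triangular_span (B : nat -> {poly R}) n P :
  (forall i, size (B i) = i.+1) -> (size P <= n)%N ->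
  exists c : nat -> R, P = \sum_(i < n) c i *: B i.
Proof.
move=> sB; elim: n P => [|n IH] P sP.
  by exists (fun=> 0); rewrite big_ord0; apply/eqP; rewrite -size_poly_leq0.
have lB : (B n)`_n != 0.
  by rewrite -[X in _`_X]/(n.+1.-1) -(sB n) -lead_coefE lead_coef_eq0 -size_poly_eq0 sB.
pose a := P`_n / (B n)`_n.
have [|c Hc] := IH (P - a *: B n).
  apply/leq_sizeP => j; rewrite leq_eqVlt => /predU1P[<-|nj].
    by rewrite coefB coefZ divfK ?subrr.
  rewrite coefB coefZ !nth_default ?mulr0 ?subrr //; first by rewrite sB.
  exact: leq_trans sP nj.
exists (fun i => if i == n then a else c i).
rewrite big_ord_recr /= eqxx -[LHS](subrK (a *: B n)) Hc; congr (_ + _).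
by apply: eq_bigr => i _; rewrite ltn_eqF.
Qed.

Lemma exists_primitive P : exists Q, P = Q^`().
Proof.
exists (\poly_(i < (size P).+1) (P`_i.-1 / i%:R)); apply/polyP => i.
rewrite coef_deriv coef_poly ltnS; case: ltnP => iP; last by rewrite mul0rn nth_default.
by rewrite /= -[RHS]mulr_natr divfK // pnatr_eq0.
Qed.

(** The integral of a polynomial against the variable of [[-1, 1]], read on the
    parameter interval [[0, 1]] of an edge. *)
Definition itg P : R := \int[@lebesgue_measure R]_(t in `[0, 1]) P.[2 * t - 1].

Lemma itg_deriv Q : itg Q^`() = (Q.[1] - Q.[-1]) / 2.
Proof.
pose F := (2^-1 *: Q) \Po (2%:P * 'X - 1).
have FE t : F.[t] = 2^-1 * Q.[2 * t - 1].
  by rewrite /F horner_comp !hornerE.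
have dF t : F^`().[t] = Q^`().[2 * t - 1].
  rewrite /F deriv_comp derivB derivM derivX !derivC hornerM horner_comp.
  by rewrite derivZ !hornerE /=; lra.
rewrite /itg /Rintegral.
under eq_integral do rewrite -dF.
rewrite (@continuous_FTC2 R (horner F^`()) (horner F)) //=.
- by rewrite !FE mulr1 mulr0; have -> : (2 - 1 = 1 :> R); [lra|rewrite sub0r; lra].
- exact/continuous_subspaceT/continuous_horner.
- split; first by move=> t _; exact: derivable_horner.
  + exact/cvg_at_right_filter/continuous_horner.
  + exact/cvg_at_left_filter/continuous_horner.
- by move=> t _; rewrite derivE.
Qed.

Lemma itgD P Q : itg (P + Q) = itg P + itg Q.
Proof.
have [A ->] := exists_primitive P; have [B ->] := exists_primitive Q.
rewrite -derivD !itg_deriv !hornerD.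
by rewrite -mulrDl; congr (_ / 2); ring.
Qed.

Lemma itgZ c P : itg (c *: P) = c * itg P.
Proof.
have [A ->] := exists_primitive P.
by rewrite -derivZ !itg_deriv !hornerZ -mulrBr mulrA.
Qed.

Lemma itg0 : itg 0 = 0.
Proof. by rewrite -(scale0r 0) itgZ mul0r. Qed.

Lemma itg_sum n (c : 'I_n -> {poly R}) : itg (\sum_i c i) = \sum_i itg (c i).
Proof. exact: (big_morph itg itgD itg0). Qed.

Lemma itg_parts A B : A.[1] * B.[1] = A.[-1] * B.[-1] ->
  itg (A^`() * B) = - itg (A * B^`()).
Proof.
move=> AB; have : itg (A^`() * B + A * B^`()) = 0.
  by rewrite -derivM itg_deriv !hornerM AB subrr mul0r.
by rewrite itgD => /eqP; rewrite addr_eq0 => /eqP.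
Qed.

(** A nonzero square has a primitive that is nondecreasing, hence constant on
    the interval if its end values agree. *)
Lemma itg_sqr_eq0 P : itg (P * P) = 0 -> P = 0.
Proof.
have [Q QE] := exists_primitive (P * P); rewrite QE itg_deriv => /eqP.
rewrite mulf_eq0 invr_eq0 pnatr_eq0 orbF subr_eq0 => /eqP Q1.
have mono (x y : R) : -1 <= x -> x <= y -> y <= 1 -> Q.[x] <= Q.[y].
  move: x y; apply: (@ger0_derive1_ndecr R (horner Q) (-1) 1).
  - by move=> x _; exact: derivable_horner.
  - by move=> x _; rewrite -derivE -QE hornerM -expr2 sqr_ge0.
  - exact/continuous_subspaceT/continuous_horner.
have : Q - Q.[1]%:P = 0.
  apply: poly_eq0_on01 => t /andP[t0 t1].
  rewrite !hornerE; apply/eqP; rewrite subr_eq0 eq_le mono ?lexx //=; try lra.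
  by rewrite {1}Q1 mono //; lra.
move/(congr1 (@deriv R)); rewrite derivB derivC subr0 -QE deriv0 => /eqP.
by rewrite mulf_eq0 orbb => /eqP.
Qed.

Lemma size_derivn_char0 P n : size P^`(n) = (size P - n)%N.
Proof.
elim: n => [|n IH]; first by rewrite derivn0 subn0.
rewrite derivnS subnS -IH; set Q := P^`(n).
have [->|Q0] := eqVneq Q 0; first by rewrite deriv0 size_poly0.
apply/eqP; rewrite eqn_leq -ltnS prednK ?size_poly_gt0 ?lt_size_deriv //=.
case: (ltnP 1 (size Q)) => sQ; last first.
  by move: sQ; case: (size Q) => [|[|]].
case E : (size Q) sQ => [|[|m]] //= _.
rewrite ltnNge; apply/negP => /leq_sizeP /(_ m (leqnn _)) /eqP.
rewrite coef_deriv mulrn_eq0 /= -[m.+1]/(m.+2.-1) -E -lead_coefE lead_coef_eq0.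
exact/negP.
Qed.

Lemma size_deriv_char0 P : size P^`() = (size P).-1.
Proof. by rewrite -derivn1 size_derivn_char0 subn1. Qed.

(** The factor [('X - c)^n] loses one power per differentiation; the cofactor
    at [c] is tracked because it gives the end values of the Legendre
    polynomials. *)
Lemma derivn_exp_XsubC (c : R) n A k : (k <= n)%N ->
  exists B, (('X - c%:P) ^+ n * A)^`(k) = ('X - c%:P) ^+ (n - k) * B /\
            B.[c] = (n ^_ k)%:R * A.[c].
Proof.
elim: k => [|k IH] kn.
  by exists A; rewrite derivn0 subn0 ffactn0 mul1r.
have [B [E Bc]] := IH (ltnW kn).
have -> : (n - k.+1 = (n - k).-1)%N by rewrite subnS.
have nk : (0 < n - k)%N by rewrite subn_gt0.
exists (B *+ (n - k) + ('X - c%:P) * B^`()); split.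
  rewrite derivnS E derivM deriv_exp derivXsubC mul1r.
  rewrite mulrDr mulrA -exprSr prednK // mulrnAl mulrnAr //.
rewrite hornerD hornerM hornerMn Bc !hornerE subrr mul0r addr0.
by rewrite ffactnSr natrM -mulr_natr; ring.
Qed.

Let wpow n : {poly R} := ('X ^+ 2 - 1) ^+ n.

Let wpow_factor n :
  (wpow n = ('X - 1%:P) ^+ n * ('X - (-1)%:P) ^+ n) *
  (wpow n = ('X - (-1)%:P) ^+ n * ('X - 1%:P) ^+ n).
Proof.
have E : wpow n = ('X - 1%:P) ^+ n * ('X - (-1)%:P) ^+ n.
  by rewrite /wpow -exprMn; congr (_ ^+ _); rewrite polyCN; ring.
by split=> //; rewrite E mulrC.
Qed.

Let wpow_derivn0 n k : (k < n)%N ->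
  (wpow n)^`(k).[1] = 0 /\ (wpow n)^`(k).[-1] = 0.
Proof.
move=> kn; split.
  have [B [E _]] := derivn_exp_XsubC 1 (('X - (-1)%:P) ^+ n) (ltnW kn).
  rewrite (wpow_factor n).1 E hornerM horner_exp hornerXsubC subrr expr0n subn_eq0.
  by rewrite leqNgt kn mul0r.
have [B [E _]] := derivn_exp_XsubC (-1) (('X - 1%:P) ^+ n) (ltnW kn).
rewrite (wpow_factor n).2 E hornerM horner_exp hornerXsubC subrr expr0n subn_eq0.
by rewrite leqNgt kn mul0r.
Qed.

Let legendre_const n : (2 ^+ n * n`!%:R : R) != 0.
Proof. by rewrite mulf_neq0 ?expf_neq0 ?pnatr_eq0 // -lt0n fact_gt0. Qed.

Lemma size_legendre n : size (legendre n : {poly R}) = n.+1.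
Proof.
rewrite /legendre size_scale ?invr_eq0 ?legendre_const // size_derivn_char0.
have s1 : size ('X ^+ 2 - 1 : {poly R}) = 3 by rewrite size_XnsubC.
have := size_exp ('X ^+ 2 - 1 : {poly R}) n; rewrite s1 /=.
have : (0 < size (('X ^+ 2 - 1 : {poly R}) ^+ n))%N.
  by rewrite size_poly_gt0 expf_neq0 // -size_poly_eq0 s1.
by case: size => // m _ /= ->; lia.
Qed.

Lemma legendre1 n : (legendre n).[1] = 1 :> R.
Proof.
rewrite /legendre -/(wpow n) hornerZ (wpow_factor n).1.
have [B [-> Bc]] := derivn_exp_XsubC 1 (('X - (-1)%:P) ^+ n) (leqnn n).
rewrite subnn expr0 mul1r Bc ffactnn horner_exp hornerXsubC opprK.
have -> : (1 + 1 = 2 :> R) by [].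
by rewrite [X in _ * X]mulrC mulVf ?legendre_const.
Qed.

Lemma legendreN1 n : (legendre n).[-1] = (-1) ^+ n :> R.
Proof.
rewrite /legendre -/(wpow n) hornerZ (wpow_factor n).2.
have [B [-> Bc]] := derivn_exp_XsubC (-1) (('X - 1%:P) ^+ n) (leqnn n).
rewrite subnn expr0 mul1r Bc ffactnn horner_exp hornerXsubC.
have -> : (-1 - 1 = -1 * 2 :> R) by lra.
rewrite exprMn; have := mulVf (legendre_const n); set v := _^-1 => E.
by rewrite -[RHS]mul1r -[in X in _ = X * _]E; ring.
Qed.

(** Rodrigues' formula differentiates an even polynomial [n] times. *)
Lemma legendre_opp n (x : R) : (legendre n).[- x] = (-1) ^+ n * (legendre n).[x].
Proof.
have coef0 i : odd (n + i) -> (legendre n : {poly R})`_i = 0.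
  move=> ni; rewrite /legendre coefZ coef_derivn.
  have -> : (('X ^+ 2 - 1) ^+ n : {poly R}) = (('X - 1) ^+ n) \Po 'X^2.
    by rewrite rmorphXn /= rmorphB /= comp_polyX rmorph1.
  by rewrite coef_comp_poly_Xn // dvdn2 ni mul0rn mulr0.
rewrite !horner_coef mulr_sumr; apply: eq_bigr => i _.
have [/coef0 ->|] := boolP (odd (n + i)); first by rewrite !mul0r mulr0.
rewrite oddD negb_add => /eqP E.
by rewrite (exprNn x i) mulrCA -(signr_odd _ i) -E signr_odd.
Qed.

(** Each integration by parts moves a derivative to [P]; the boundary terms
    vanish because a derivative of order less than [n] keeps the factors
    [X - 1] and [X + 1]. *)
Lemma legendre_orthog n P : (size P <= n)%N -> itg (P * legendre n) = 0.
Proof.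
move=> sP; rewrite /legendre -/(wpow n) -scalerAr itgZ mulrC.
suff H k : (k <= n)%N -> forall Q, (size Q <= k)%N -> itg ((wpow n)^`(k) * Q) = 0.
  by rewrite [P * _]mulrC H ?mul0r.
elim: k => [|k IH] kn Q sQ.
  have -> : Q = 0 by apply/eqP; rewrite -size_poly_leq0.
  by rewrite mulr0 itg0.
have [w1 wN1] := wpow_derivn0 kn.
rewrite derivnS itg_parts ?w1 ?wN1 ?mul0r // IH ?oppr0 ?(ltnW kn) //.
by rewrite size_deriv_char0; move: sQ; case: (size Q).
Qed.

(** Expanding [r] in the Legendre basis, each vanishing moment kills one
    coefficient. *)
Lemma legendre_moments p r : (0 < p)%N -> (size r <= p.+1)%N ->
  (forall j, (j <= p - 2)%N || (j == p) -> itg (r * legendre j) = 0) ->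
  exists a, r = a *: legendre (p - 1).
Proof.
move=> p0 sr Hr; have [c cE] := triangular_span size_legendre sr.
have coefE0 (j : nat) : (j < p.+1)%N ->
    itg (r * legendre j) = c j * itg (legendre j * legendre j).
  move=> jp; rewrite cE mulr_suml itg_sum (bigD1 (Ordinal jp)) //= -scalerAl itgZ.
  rewrite big1 ?addr0 // => i ij; rewrite -scalerAl itgZ.
  case: (ltngtP i j) => [lij|lji|eij]; last by rewrite -val_eqE /= eij eqxx in ij.
    by rewrite legendre_orthog ?mulr0 // size_legendre.
  by rewrite mulrC [X in itg X]mulrC legendre_orthog ?mul0r // size_legendre.
have c0 j : (j < p.+1)%N -> j != (p - 1)%N -> c j = 0.
  move=> jp jn; have : c j * itg (legendre j * legendre j) = 0.
    by rewrite -coefE0 // Hr //; lia.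
  move/eqP; rewrite mulf_eq0 => /orP[/eqP//|/eqP /itg_sqr_eq0 /eqP].
  by rewrite -size_poly_eq0 size_legendre.
have p1 : (p - 1 < p.+1)%N by lia.
exists (c (p - 1)%N); rewrite cE (bigD1 (Ordinal p1)) //= big1 ?addr0 // => i ip.
by rewrite c0 ?scale0r.
Qed.

End Univariate.

(** * Linear classes of functions *)

Section LinearClass.
Context {R : realType}.
Implicit Types (f g : R * R -> R) (Q : (R * R -> R) -> Prop).

(** Closure under linear combinations, for classes of functions given by a
    predicate that need not be a span. *)
Definition linear_class Q :=
  [/\ Q (fun=> 0), forall f g, Q f -> Q g -> Q (fun z => f z + g z) &
      forall c f, Q f -> Q (fun z => c * f z)].

Lemma linear_class_sum Q (I : Type) (r : seq I) (P : pred I) (F : I -> R * R -> R) :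
  linear_class Q -> (forall i, P i -> Q (F i)) ->
  Q (fun z => \sum_(i <- r | P i) F i z).
Proof.
move=> [Q0 QD _] QF; elim: r => [|i r IH].
  by under eq_fun do rewrite big_nil; exact: Q0.
under eq_fun do rewrite big_cons; case Pi: (P i) => //.
exact: QD (QF _ Pi) IH.
Qed.

Lemma linear_span_closed (S : set (R * R -> R)) : linear_class (linear_span S).
Proof.
split.
- exists 0%N, (fun=> 0), (fun=> fun=> 0); split; first by case.
  by move=> z; rewrite big_ord0.
- move=> _ _ [m [c [f [Sf /funext ->]]]] [n [d [g [Sg /funext ->]]]].
  exists (m + n)%N,
    (fun i => match fintype.split i with inl j => c j | inr j => d j end),
    (fun i => match fintype.split i with inl j => f j | inr j => g j end); split.
    by move=> i; case: fintype.split.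
  move=> z; rewrite big_split_ord; congr (_ + _); apply: eq_bigr => i _.
    by case: fintype.splitP => j /=; [move=> /ord_inj ->|have := ltn_ord i; lia].
  by case: fintype.splitP => j /= ; [have := ltn_ord j; lia|move=> /addnI/ord_inj ->].
- move=> a _ [m [c [f [Sf /funext ->]]]].
  exists m, (fun i => a * c i), f; split=> // z.
  by rewrite mulr_sumr; apply: eq_bigr => i _; rewrite mulrA.
Qed.

Lemma linear_span_gen (S : set (R * R -> R)) f : S f -> linear_span S f.
Proof.
move=> Sf; exists 1%N, (fun=> 1), (fun=> f); split=> // z.
by rewrite big_ord1 mul1r.
Qed.

Lemma linear_span_sub (S : set (R * R -> R)) Q f :
  linear_class Q -> (forall g, S g -> Q g) -> linear_span S f -> Q f.
Proof.
move=> LQ SQ [n [c [g [Sg /funext ->]]]].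
by apply: linear_class_sum => // i _; case: LQ => _ _; apply; exact: SQ.
Qed.

End LinearClass.

(** * Polynomials in two functions of the plane *)

Section PlanePoly.
Context {R : realType}.
Implicit Types (f g s t : R * R -> R).

(** Polynomials of total degree less than [n] in two functions [s] and [t].
    Splitting off the part free of [t] makes divisibility by [t] the
    vanishing of one univariate polynomial. *)
Fixpoint plane_poly s t (n : nat) f : Prop :=
  if n is m.+1 then
    exists (A : {poly R}) g, [/\ (size A <= m.+1)%N, plane_poly s t m g &
      forall z, f z = A.[s z] + t z * g z]
  else forall z, f z = 0.

Lemma plane_poly_closed s t n : linear_class (plane_poly s t n).
Proof.
elim: n => [|n [Q0 QD QZ]].
  by split=> //= [f g f0 g0 z|c f f0 z]; rewrite ?f0 ?g0 ?addr0 ?mulr0.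
split.
- exists 0, (fun=> 0); split=> //; first by rewrite size_poly0.
  by move=> z; rewrite horner0 mulr0 addr0.
- move=> f g [A [u [sA Qu fE]]] [B [v [sB Qv gE]]].
  exists (A + B), (fun z => u z + v z); split; first 2 [exact: QD].
    by rewrite (leq_trans (size_polyD _ _)) // geq_max sA.
  by move=> z; rewrite fE gE hornerD; ring.
- move=> c f [A [u [sA Qu fE]]].
  exists (c *: A), (fun z => c * u z); split.
    exact: leq_trans (size_scale_leq _ _) sA.
    exact: QZ.
  by move=> z; rewrite fE hornerZ; ring.
Qed.

Lemma plane_polyS s t n f : plane_poly s t n f -> plane_poly s t n.+1 f.
Proof.
elim: n f => [|n IH] f.
  move=> /= f0; exists 0, (fun=> 0); split=> //; first by rewrite size_poly0.
  by move=> z; rewrite f0 horner0 mulr0 addr0.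
move=> [A [u [sA Qu fE]]]; exists A, u; split=> //; first exact: leqW.
exact: IH.
Qed.

Lemma plane_poly_leq s t m n f :
  (m <= n)%N -> plane_poly s t m f -> plane_poly s t n f.
Proof.
move=> /subnK <-; elim: (n - m)%N => // k IH /IH.
by rewrite addSn; exact: plane_polyS.
Qed.

Lemma plane_poly_mulr s t n f :
  plane_poly s t n f -> plane_poly s t n.+1 (fun z => t z * f z).
Proof.
move=> Qf; exists 0, f; split=> //; first by rewrite size_poly0.
by move=> z; rewrite horner0 add0r.
Qed.

Lemma plane_poly_mull s t n f :
  plane_poly s t n f -> plane_poly s t n.+1 (fun z => s z * f z).
Proof.
elim: n f => [|n IH] f.
  move=> /= f0; exists 0, (fun=> 0); split=> //; first by rewrite size_poly0.
  by move=> z; rewrite f0 horner0 !mulr0 addr0.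
move=> [A [u [sA Qu fE]]].
exists (A * 'X), (fun z => s z * u z); split.
- have [->|A0] := eqVneq A 0; first by rewrite mul0r size_poly0.
  by rewrite size_mulX.
- exact: IH.
- by move=> z; rewrite fE hornerMX; ring.
Qed.

Lemma plane_poly1 s t : plane_poly s t 1 (fun=> 1).
Proof.
exists 1, (fun=> 0); split=> //; first by rewrite size_poly1.
by move=> z; rewrite hornerC mulr0 addr0.
Qed.

(** Linear properties of polynomials need only be checked on monomials. *)
Lemma plane_poly_class_ind s t n f Q : linear_class Q ->
  (forall i j, (i + j < n)%N -> Q (fun z => s z ^+ i * t z ^+ j)) ->
  plane_poly s t n f -> Q f.
Proof.
elim: n f Q => [|n IH] f Q LQ Qm; have [Q0 QD QZ] := LQ; first by move=> /= /funext ->.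
move=> [A [g [sA Pg /funext ->]]]; apply: (QD _ _).
  rewrite (_ : (fun z => A.[s z]) =
     (fun z => \sum_(i < n.+1) A`_i * (s z ^+ i * t z ^+ 0))); last first.
    apply/funext => z; rewrite (horner_coef_wide _ sA).
    by apply: eq_bigr => i _; rewrite expr0 mulr1.
  apply: linear_class_sum => // i _; apply: (QZ _ _); apply: (Qm _ _).
  by rewrite addn0; exact: ltn_ord.
apply: (IH g (fun g => Q (fun z => t z * g z))) => //.
- split.
  + by under eq_fun do rewrite mulr0.
  + by move=> u v Qu Qv; under eq_fun do rewrite mulrDr; exact: QD.
  + by move=> c u Qu; under eq_fun do rewrite mulrCA; exact: QZ.
- move=> i j ij; have := Qm i j.+1.
  rewrite addnS ltnS => /(_ ij); congr (Q _); apply/funext => z.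
  by rewrite exprS; ring.
Qed.

Definition affine_in s t (l : R * R -> R) :=
  exists a b c, forall z, l z = a + b * s z + c * t z.

Lemma plane_poly_mul_affine s t n f l : affine_in s t l ->
  plane_poly s t n f -> plane_poly s t n.+1 (fun z => l z * f z).
Proof.
move=> [a [b [c lE]]] Pf; have [Q0 QD QZ] := plane_poly_closed s t n.+1.
rewrite (_ : (fun z => _) =
  (fun z => a * f z + b * (s z * f z) + c * (t z * f z))); last first.
  by apply/funext => z; rewrite lE; ring.
apply: (QD _ _); last exact/QZ/plane_poly_mulr.
apply: (QD _ _); last exact/QZ/plane_poly_mull.
exact/QZ/plane_polyS.
Qed.

Lemma plane_poly_mul_affineX s t n f l k : affine_in s t l ->
  plane_poly s t n f -> plane_poly s t (k + n) (fun z => l z ^+ k * f z).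
Proof.
move=> al Pf; elim: k => [|k IH]; first by under eq_fun do rewrite mul1r.
rewrite addSn; under eq_fun do rewrite exprS -mulrA.
exact: plane_poly_mul_affine.
Qed.

Lemma plane_poly_mul_comp s t n f l k (A : {poly R}) : affine_in s t l ->
  (size A <= k.+1)%N ->
  plane_poly s t n f -> plane_poly s t (k + n) (fun z => A.[l z] * f z).
Proof.
move=> al sA Pf; rewrite (_ : (fun z => _) =
   (fun z => \sum_(i < k.+1) A`_i * (l z ^+ i * f z))); last first.
  apply/funext => z; rewrite (horner_coef_wide _ sA) mulr_suml.
  by apply: eq_bigr => i _; rewrite mulrA.
have LQ := plane_poly_closed s t (k + n).
apply: linear_class_sum => // i _; case: LQ => _ _; apply.
apply: (@plane_poly_leq _ _ (i + n)); first by rewrite leq_add2r -ltnS.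
exact: plane_poly_mul_affineX.
Qed.

Lemma plane_poly_monomial s t u v n i j : affine_in s t u -> affine_in s t v ->
  (i + j < n)%N -> plane_poly s t n (fun z => u z ^+ i * v z ^+ j).
Proof.
move=> au av ij.
rewrite (_ : (fun z => _) = (fun z => u z ^+ i * (v z ^+ j * 1))); last first.
  by apply/funext => z; rewrite mulr1.
apply: (@plane_poly_leq _ _ (i + (j + 1))); first by rewrite addnA addn1.
apply: plane_poly_mul_affineX => //.
by apply: plane_poly_mul_affineX => //; exact: plane_poly1.
Qed.

Lemma affine_in_fst : affine_in fst snd fst.
Proof. by exists 0, 1, 0 => z; ring. Qed.

Lemma affine_in_snd : affine_in fst snd snd.
Proof. by exists 0, 0, 1 => z; ring. Qed.

Lemma plane_poly_change s t s' t' n f : affine_in s t s' -> affine_in s t t' ->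
  plane_poly s' t' n f -> plane_poly s t n f.
Proof.
move=> as' at'; apply: plane_poly_class_ind; first exact: plane_poly_closed.
by move=> i j; exact: plane_poly_monomial.
Qed.

(** If [f] vanishes at infinitely many points of the line [t = 0], the part of
    [f] free of [t] is zero. *)
Lemma plane_poly_factor s t n f : plane_poly s t n f ->
  (forall x : R, 0 < x < 1 -> exists z, [/\ s z = x, t z = 0 & f z = 0]) ->
  exists2 g, plane_poly s t n.-1 g & forall z, f z = t z * g z.
Proof.
case: n => [|n] /=.
  by move=> f0 _; exists (fun=> 0) => // z; rewrite f0 mulr0.
move=> [A [g [sA Pg fE]]] H; exists g => // z; rewrite fE.
rewrite (_ : A = 0) ?horner0 ?add0r //; apply: poly_eq0_on01 => x /H[y [sy ty fy]].
by move: fy; rewrite fE sy ty mul0r addr0.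
Qed.

Lemma poly_fun_closed p : linear_class (@poly_fun R p).
Proof.
split.
- exists (fun _ _ => 0) => z; rewrite big1 // => i _; rewrite big1 // => j _.
  by rewrite !mul0r.
- move=> f g [c cE] [d dE]; exists (fun i j => c i j + d i j) => z.
  rewrite cE dE -big_split; apply: eq_bigr => i _; rewrite -big_split.
  by apply: eq_bigr => j _; rewrite !mulrDl.
- move=> a f [c cE]; exists (fun i j => a * c i j) => z.
  rewrite cE mulr_sumr; apply: eq_bigr => i _; rewrite mulr_sumr.
  by apply: eq_bigr => j _; rewrite !mulrA.
Qed.

Lemma poly_funE p f : poly_fun p f <-> plane_poly fst snd p.+1 f.
Proof.
split=> [[c /funext ->]|].
  have LQ := plane_poly_closed fst snd p.+1.
  apply: linear_class_sum => // i _; apply: linear_class_sum => // j ij.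
  rewrite (_ : (fun z => _) = (fun z => c i j * (z.1 ^+ i * z.2 ^+ j))); last first.
    by apply/funext => z; rewrite mulrA.
  case: LQ => _ _; apply; apply: plane_poly_monomial => //.
    exact: affine_in_fst.
  exact: affine_in_snd.
apply: plane_poly_class_ind; first exact: poly_fun_closed.
move=> i j ij; exists (fun k l => ((k == i) && (l == j))%:R) => z.
have ip : (i < p.+1)%N by lia.
have jp : (j < p.+1)%N by lia.
rewrite (bigD1 (Ordinal ip)) //= (bigD1 (Ordinal jp)) //= !eqxx mul1r.
rewrite !big1 ?addr0 //.
  move=> k; rewrite -val_eqE /= => /negPf ki; rewrite big1 // => l _.
  by rewrite ki !mul0r.
move=> l /andP[_]; rewrite -val_eqE /= => /negPf lj.
by rewrite lj !mul0r.
Qed.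

Lemma plane_poly_segment n f (a b : R * R) : plane_poly fst snd n f ->
  exists2 r : {poly R}, (size r <= n)%N & forall x, f (a + x *: (b - a)) = r.[x].
Proof.
apply: (@plane_poly_class_ind _ _ _ _ (fun f => exists2 r : {poly R},
  (size r <= n)%N & forall x, f (a + x *: (b - a)) = r.[x])).
  split.
  - by exists 0; [rewrite size_poly0|move=> x; rewrite horner0].
  - move=> u v [r sr ur] [r' sr' vr]; exists (r + r').
      by rewrite (leq_trans (size_polyD _ _)) // geq_max sr.
    by move=> x; rewrite ur vr hornerD.
  - move=> c u [r sr ur]; exists (c *: r).
      exact: leq_trans (size_scale_leq _ _) sr.
    by move=> x; rewrite ur hornerZ.
move=> i j ij.
have slin (c d : R) k : (size ((c%:P + d *: 'X) ^+ k)%R <= k.+1)%N.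
  rewrite (leq_trans (size_exp_leq _ _)) // ltnS.
  have : (size (c%:P + d *: 'X)%R <= 2)%N.
    rewrite (leq_trans (size_polyD _ _)) // geq_max (leq_trans (size_polyC_leq1 _)) //.
    by rewrite (leq_trans (size_scale_leq _ _)) // size_polyX.
  by case: size => [|[|[|]]] //= _; lia.
exists ((a.1%:P + (b - a).1 *: 'X) ^+ i * (a.2%:P + (b - a).2 *: 'X) ^+ j).
  rewrite (leq_trans (size_polyMleq _ _)) //.
  have := slin a.1 (b - a).1 i; have := slin a.2 (b - a).2 j; lia.
move=> x; rewrite hornerM !horner_exp !hornerD !hornerC !hornerZ !hornerX.
by rewrite ![_ * x]mulrC.
Qed.

(** A monomial expands in products of Legendre polynomials of no larger degree,
    because the Legendre polynomials have consecutive degrees. *)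
Lemma plane_poly_legendre_ind s t n f Q : linear_class Q ->
  (forall i j, (i + j < n)%N ->
    Q (fun z => (legendre i).[s z] * (legendre j).[t z])) ->
  plane_poly s t n f -> Q f.
Proof.
move=> LQ Qm; apply: plane_poly_class_ind => // i j ij.
have X_span k : exists c : nat -> R, 'X^k = \sum_(l < k.+1) c l *: legendre l.
  by apply: triangular_span; [exact: size_legendre|rewrite size_polyXn].
have [c cE] := X_span i; have [d dE] := X_span j.
rewrite (_ : (fun z => _) = (fun z => \sum_(k < i.+1) \sum_(l < j.+1)
    (c k * d l) * ((legendre k).[s z] * (legendre l).[t z]))); last first.
  apply/funext => z; rewrite -(hornerXn (s z) i) -(hornerXn (t z) j) cE dE.
  rewrite !horner_sum mulr_suml.
  apply: eq_bigr => k _; rewrite mulr_sumr; apply: eq_bigr => l _.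
  by rewrite !hornerZ; ring.
apply: linear_class_sum => // k _; apply: linear_class_sum => // l _.
by case: LQ => _ _; apply; apply: Qm; have := ltn_ord k; have := ltn_ord l; lia.
Qed.

End PlanePoly.

(** * Plane geometry *)

Section PlaneLemmas.
Context {R : realType}.
Implicit Types (n m d x y : R * R) (f : R * R -> R).

Lemma scale_pairE (c : R) x : c *: x = (c * x.1, c * x.2).
Proof. by []. Qed.

Lemma plane_poly_continuous (k : nat) f : plane_poly fst snd k f -> continuous f.
Proof.
apply: (plane_poly_class_ind (Q := fun u : R * R -> R => continuous u)).
  split=> [x|u v cu cv x|c u cu x]; first exact: cvg_cst.
    exact: (cvgD (cu x) (cv x)).
  by apply: cvgM (cu x); exact: cvg_cst.
have cX (h : R * R -> R) l : continuous h -> continuous (fun z => h z ^+ l).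
  by move=> ch x; exact: (continuous_comp (ch x) (@exprn_continuous R l _)).
move=> i j _ x; apply: cvgM; apply: cX => y; [exact: cvg_fst|exact: cvg_snd].
Qed.

Lemma affine_plane_poly f : affine_in fst snd f -> plane_poly fst snd 2 f.
Proof.
move=> af; rewrite (_ : f = fun z => f z * 1); last by apply/funext => z; rewrite mulr1.
exact/plane_poly_mul_affine/plane_poly1.
Qed.

Lemma affine_continuous f : affine_in fst snd f -> continuous f.
Proof. by move=> /affine_plane_poly; exact: plane_poly_continuous. Qed.

Lemma affine_line f x y (t : R) : affine_in fst snd f ->
  f (x + t *: (y - x)) = (1 - t) * f x + t * f y.
Proof. by move=> [a [b [c fE]]]; rewrite !fE scale_pairE /=; ring. Qed.

Lemma ord3P (P : 'I_3 -> Prop) : P 0 -> P 1 -> P 2 -> forall i, P i.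
Proof.
move=> P0 P1 P2 [[|[|[|//]]] i3].
- by rewrite (_ : Ordinal i3 = 0) //; exact: val_inj.
- by rewrite (_ : Ordinal i3 = 1) //; exact: val_inj.
- by rewrite (_ : Ordinal i3 = 2) //; exact: val_inj.
Qed.

Lemma ord3_add : ((0 + 1 = 1 :> 'I_3)%R * (0 + 2 = 2 :> 'I_3)%R *
  (1 + 1 = 2 :> 'I_3)%R * (1 + 2 = 0 :> 'I_3)%R * (2 + 1 = 0 :> 'I_3)%R *
  (2 + 2 = 1 :> 'I_3)%R)%type.
Proof. by do !split; exact: val_inj. Qed.

Lemma sum_ord3 (V : nmodType) (F : 'I_3 -> V) : \sum_i F i = F 0 + F 1 + F 2.
Proof.
rewrite !big_ord_recl big_ord0 addr0 addrA.
by congr (F _ + F _ + F _); exact: val_inj.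
Qed.

Lemma affine_comb f (w : 'I_3 -> R) (P : 'I_3 -> R * R) : affine_in fst snd f ->
  \sum_j w j = 1 -> f (\sum_j w j *: P j) = \sum_j w j * f (P j).
Proof.
move=> [a [b [c fE]]]; rewrite !sum_ord3 !fE => w1.
by rewrite !scale_pairE /= -[a in LHS]mulr1 -w1; ring.
Qed.

Lemma line_continuous x d : continuous (fun t : R => x + t *: d).
Proof.
move=> t; apply: cvgD; first exact: cvg_cst.
exact: scalel_continuous.
Qed.

Lemma dotNl n m : dot (- n) m = - dot n m.
Proof. by rewrite /dot /=; ring. Qed.

Lemma dotNr n m : dot n (- m) = - dot n m.
Proof. by rewrite /dot /=; ring. Qed.

Lemma dot_gt0 n : n != 0 -> 0 < dot n n.
Proof.
case: n => a b n0; rewrite /dot /= -!expr2 lt_neqAle addr_ge0 ?sqr_ge0 // andbT.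
rewrite eq_sym paddr_eq0 ?sqr_ge0 // !sqrf_eq0.
apply: contraNN n0 => /andP[/eqP-> /eqP->].
by [].
Qed.

(** Two unit vectors of the plane orthogonal to the same line have vanishing
    cross product, so their scalar product is 1 or -1. *)
Lemma unit_normals_eq n m d : d != 0 -> dot n n = 1 -> dot m m = 1 ->
  dot n d = 0 -> dot m d = 0 -> n = m \/ n = - m.
Proof.
move=> d0 n1 m1 nd md.
have c0 : cross n m = 0.
  apply: (mulIf (lt0r_neq0 (dot_gt0 d0))); rewrite mul0r.
  have -> : cross n m * dot d d = dot n d * cross d m + cross n d * dot m d.
    by rewrite /cross /dot; ring.
  by rewrite nd md; ring.
have : dot n m ^+ 2 = 1.
  have : dot n m ^+ 2 + cross n m ^+ 2 = dot n n * dot m m.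
    by rewrite /cross /dot; ring.
  by rewrite c0 n1 m1 expr0n addr0 mulr1.
have zero (u : R * R) : dot u u = 0 -> u = 0.
  by move=> u0; case: (eqVneq u 0) => // /dot_gt0; rewrite u0 ltxx.
move=> /eqP; rewrite sqrf_eq1 => /orP[] /eqP nm; [left|right].
- apply/subr0_eq/zero.
  have -> : dot (n - m) (n - m) = dot n n + dot m m - 2 * dot n m.
    by rewrite /dot /=; ring.
  by rewrite n1 m1 nm; ring.
- apply/eqP; rewrite -addr_eq0; apply/eqP/zero.
  have -> : dot (n + m) (n + m) = dot n n + dot m m + 2 * dot n m.
    by rewrite /dot /=; ring.
  by rewrite n1 m1 nm; ring.
Qed.

End PlaneLemmas.

(** * Barycentric coordinates and normals *)

Section Triangles.
Context {R : realType} {T : mesh R}.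
Hypothesis nondegenerate : forall K : elt T,
  cross (pos (vtx K 1) - pos (vtx K 0)) (pos (vtx K 2) - pos (vtx K 0)) != 0.
Implicit Types (K : elt T) (i j : 'I_3) (x y : R * R).

Lemma cyclic_det K i :
  cross (pos (vtx K (i + 1)) - pos (vtx K i)) (pos (vtx K (i + 2)) - pos (vtx K i)) =
  cross (pos (vtx K 1) - pos (vtx K 0)) (pos (vtx K 2) - pos (vtx K 0)).
Proof. by move: i; apply: ord3P; rewrite !ord3_add // /cross /=; ring. Qed.

Lemma baryE K i x : bary K i x =
  cross (pos (vtx K (i + 1)) - x) (pos (vtx K (i + 2)) - x) /
  cross (pos (vtx K 1) - pos (vtx K 0)) (pos (vtx K 2) - pos (vtx K 0)).
Proof. by rewrite /bary cyclic_det. Qed.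

Lemma bary_affine K i : affine_in fst snd (bary K i).
Proof.
set b := pos (vtx K (i + 1)); set c := pos (vtx K (i + 2)).
set D := cross (pos (vtx K 1) - pos (vtx K 0)) (pos (vtx K 2) - pos (vtx K 0)).
exists (cross b c / D), ((b.2 - c.2) / D), ((c.1 - b.1) / D) => z.
by rewrite baryE /cross -/b -/c -/D /=; ring.
Qed.

Lemma bary_continuous K i : continuous (bary K i).
Proof. exact/affine_continuous/bary_affine. Qed.

Lemma bary_sum K x : \sum_i bary K i x = 1.
Proof.
rewrite sum_ord3 !baryE !ord3_add -!mulrDl; have := nondegenerate K.
set D := cross _ _ => D0; apply/eqP; rewrite -(inj_eq (mulIf D0)) divfK // mul1r.
by rewrite /D /cross /=; apply/eqP; ring.
Qed.

Lemma bary_pos K x : x = \sum_i bary K i x *: pos (vtx K i).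
Proof.
rewrite sum_ord3 !baryE !ord3_add !scale_pairE; have := nondegenerate K.
case: x (pos (vtx K 0)) (pos (vtx K 1)) (pos (vtx K 2)) => [x y] [x0 y0] [x1 y1] [x2 y2].
rewrite /cross /= => D0; congr pair => /=; field; exact: D0.
Qed.

Lemma bary_comb K (w : 'I_3 -> R) i : \sum_j w j = 1 ->
  bary K i (\sum_j w j *: pos (vtx K j)) = w i.
Proof.
rewrite !sum_ord3 => w1; have {w1} w0 : w 0 = 1 - w 1 - w 2 by rewrite -w1; ring.
move: i; apply: ord3P; rewrite baryE !ord3_add w0 !scale_pairE; have := nondegenerate K;
case: (pos (vtx K 0)) (pos (vtx K 1)) (pos (vtx K 2)) => [x0 y0] [x1 y1] [x2 y2];
by rewrite /cross /= => D0; field; exact: D0.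
Qed.

Lemma bary_vtx K i j : bary K i (pos (vtx K j)) = (i == j)%:R.
Proof.
rewrite -[pos (vtx K j)](_ : \sum_k (k == j)%:R *: pos (vtx K k) = _); last first.
  rewrite (bigD1 j) //= eqxx scale1r big1 ?addr0 // => k /negPf ->.
  by rewrite scale0r.
rewrite bary_comb // (bigD1 j) //= eqxx big1 ?addr0 // => k /negPf ->; exact: erefl.
Qed.

Lemma vtx_inj K : injective (vtx K).
Proof.
move=> i j E; have := bary_vtx K i i; rewrite E bary_vtx eqxx.
by case: eqP => // _ /esym /eqP; rewrite oner_eq0.
Qed.

Lemma vtx_in_edge K i j : (vtx K i \in edge K j) = (i != j).
Proof.
apply/imsetP/idP => [[k]|ij]; first by rewrite inE => kj /vtx_inj ->.
by exists i => //; rewrite inE.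
Qed.

Lemma edge_inj K : injective (edge K).
Proof.
move=> i j E; apply/eqP/negPn; rewrite -(vtx_in_edge K) -E vtx_in_edge.
by rewrite eqxx.
Qed.

Lemma edge_in_edges K i : edge K i \in edges K.
Proof. exact: imset_f. Qed.

Lemma edgesP K (F : {set node T}) : F \in edges K -> exists i, F = edge K i.
Proof. by move=> /imsetP[i _ ->]; exists i. Qed.

Lemma bary_nodeE K i x : bary_node K (vtx K i) x = bary K i x.
Proof.
rewrite /bary_node; case: pickP => [j /eqP /vtx_inj -> //|/(_ i)].
by rewrite eqxx.
Qed.

Lemma bary_edgeE K i x : bary_edge K (edge K i) x = bary K i x.
Proof.
rewrite /bary_edge; case: pickP => [j /eqP /edge_inj -> //|/(_ i)].
by rewrite eqxx.
Qed.

Lemma triangleP K x : triangle K x <-> forall i, 0 <= bary K i x.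
Proof.
split=> [[w [w0]]|b0].
  rewrite !big_imset /=; [|by move=> ? ? _ _; exact: vtx_inj..].
  under eq_bigl do rewrite inE; under [in X in _ -> X -> _]eq_bigl do rewrite inE.
  by move=> w1 -> i; rewrite bary_comb.
exists (fun n => bary_node K n x).
rewrite !big_imset /=; [|by move=> ? ? _ _; exact: vtx_inj..].
split.
- by move=> n; rewrite /bary_node; case: pickP.
- rewrite -[RHS](bary_sum K x); apply: eq_big => [i|i _]; first by rewrite inE.
  by rewrite bary_nodeE.
- rewrite {1}[x](bary_pos K x); apply: eq_big => [i|i _]; first by rewrite inE.
  by rewrite bary_nodeE.
Qed.

Lemma hull_edge_bary0 K i x : hull (edge K i) x -> bary K i x = 0.
Proof.
move=> [w [w0]].
rewrite !big_imset /=; [|by move=> ? ? _ _; exact: vtx_inj..].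
move=> w1 ->; pose w' j := if j != i then w (vtx K j) else 0.
have -> : \sum_(j in [set j | j != i]%SET) w (vtx K j) *: pos (vtx K j) =
    \sum_j w' j *: pos (vtx K j).
  rewrite big_mkcond; apply: eq_bigr => j _; rewrite inE /w'.
  by case: ifP => // _; rewrite scale0r.
rewrite bary_comb ?/w' ?eqxx // -w1 [RHS]big_mkcond.
by apply: eq_bigr => j _; rewrite inE.
Qed.

Lemma interior_triangleP K x : (triangle K)° x <-> forall i, 0 < bary K i x.
Proof.
split=> [xK i|b0].
  have /triangleP b0 := interior_subset xK.
  rewrite lt_neqAle b0 andbT eq_sym; apply/eqP => bi.
  (* a small step away from the opposite vertex would leave the triangle *)
  have := @line_continuous R x (pos (vtx K i) - x) 0.
  rewrite /continuous_at scale0r addr0 => /(_ _ xK) /nbhs_ballP[e /= e0 He].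
  have /triangleP /(_ i) : triangle K (x + (- (e / 2)) *: (pos (vtx K i) - x)).
    apply: He; rewrite /ball /= sub0r opprK ger0_norm ?divr_ge0 ?ltW //.
    by rewrite ltr_pdivrMr // ltr_pMr // ltr1n.
  rewrite affine_line ?bi ?bary_vtx ?eqxx; last exact: bary_affine.
  by rewrite mulr0 add0r mulr1 oppr_ge0 leNgt divr_gt0.
have op : \forall y \near x, forall i, 0 < bary K i y.
  apply: (@filter_forall _ _ (fun i y => 0 < bary K i y) (nbhs x)) => i.
  apply: (@bary_continuous K i x [set t | 0 < t]).
  by apply: open_nbhs_nbhs; split; [exact: open_gt|exact: b0].
by apply: filterS op => y yb; apply/triangleP => i; exact/ltW/yb.
Qed.

Definition centroid K : R * R := \sum_j (3^-1 : R) *: pos (vtx K j).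

Lemma bary_centroid K i : bary K i (centroid K) = 3^-1.
Proof. by rewrite bary_comb // sum_ord3; lra. Qed.

Lemma centroid_interior K : (triangle K)° (centroid K).
Proof. by apply/interior_triangleP => i; rewrite bary_centroid invr_gt0. Qed.

Lemma line_to_centroid_interior K x (t : R) : triangle K x -> 0 < t <= 1 ->
  (triangle K)° (x + t *: (centroid K - x)).
Proof.
move=> /triangleP b0 /andP[t0 t1]; apply/interior_triangleP => i.
rewrite affine_line; last exact: bary_affine.
rewrite bary_centroid; apply: ltr_wpDl; first by rewrite mulr_ge0 ?subr_ge0.
by rewrite mulr_gt0 // invr_gt0.
Qed.

(** The outward normal is characterised by its sign against the opposite
    vertex, whichever way the edge is traversed. *)
Lemma outward_normalP K i : let n := outward_normal K (edge K i) in
  [/\ dot n n = 1,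
      forall k l, k \in edge K i -> l \in edge K i -> dot n (pos k - pos l) = 0 &
      forall k, k \in edge K i -> dot n (pos (vtx K i) - pos k) < 0].
Proof.
have -> : outward_normal K (edge K i) =
  let a := pos (vtx K (i + 1)) in
  let b := pos (vtx K (i + 2)) in
  let n := (enorm (b - a))^-1 *: ((b - a).2, - (b - a).1) in
  if dot n (pos (vtx K i) - a) < 0 then n else - n.
  rewrite /outward_normal; case: pickP => [j /eqP /edge_inj -> //|/(_ i)].
  by rewrite eqxx.
move=> /=; set a := pos (vtx K (i + 1)); set b := pos (vtx K (i + 2)).
set m := _ *: _; set n := if _ then _ else _.
have ab : b - a != 0.
  apply: contraNneq (nondegenerate K) => ba.
  rewrite -(cyclic_det K i) -/a -/b (subr0_eq ba) /cross; apply/eqP; ring.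
have e0 : 0 < enorm (b - a) by rewrite sqrtr_gt0 dot_gt0.
have mm : dot m m = 1.
  have -> : dot m m = (enorm (b - a))^-1 ^+ 2 * dot (b - a) (b - a).
    by rewrite /m scale_pairE /dot /=; ring.
  rewrite -[dot (b - a) _]sqr_sqrtr ?(ltW (dot_gt0 ab)) // -exprMn.
  by rewrite mulVf ?expr1n // gt_eqF.
have mab : dot m (b - a) = 0 by rewrite /m scale_pairE /dot /=; ring.
have nE : n = m \/ n = - m by rewrite /n; case: ifP; [left|right].
have nn : dot n n = 1 by case: nE => ->; rewrite ?dotNl ?dotNr ?opprK.
have nab : dot n (b - a) = 0 by case: nE => ->; rewrite ?dotNl mab ?oppr0.
have edgeE k : k \in edge K i -> pos k = a \/ pos k = b.
  move=> /imsetP[j]; rewrite inE => ji ->.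
  have : j = i + 1 \/ j = i + 2.
    move: i j ji {a b m n ab e0 mm mab nE nn nab}.
    by apply: ord3P; apply: ord3P; rewrite !ord3_add //; auto.
  by case=> ->; [left|right].
have nl k : k \in edge K i -> dot n (pos k) = dot n a.
  move=> /edgeE[->//|->]; apply/eqP; rewrite -subr_eq0 -nab.
  by apply/eqP; rewrite /dot /=; ring.
have dotB x y : dot n (x - y) = dot n x - dot n y by rewrite /dot /=; ring.
split=> //.
- by move=> k l /nl kE /nl lE; rewrite dotB kE lE subrr.
- move=> k /nl kE; rewrite dotB kE -dotB.
  have : dot m (pos (vtx K i) - a) != 0.
    have -> : dot m (pos (vtx K i) - a) = - (enorm (b - a))^-1 *
        cross (a - pos (vtx K i)) (b - pos (vtx K i)).
      by rewrite /m scale_pairE /dot /cross /=; ring.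
    rewrite mulf_neq0 ?oppr_eq0 ?invr_eq0 ?(gt_eqF e0) //.
    by rewrite (cyclic_det K i) nondegenerate.
  rewrite neq_lt /n => /orP[] mi; first by rewrite mi.
  by rewrite (lt_gtF mi) dotNl oppr_lt0.
Qed.

End Triangles.

(** * Neighbouring triangles *)

Section Conforming.
Context {R : realType} {T : mesh R} {Omega : set (R * R)}.
Hypothesis Tconf : @conforming_mesh R T Omega.
Implicit Types (K : elt T) (i j : 'I_3) (F : {set node T}).

Let nondeg := mesh_nondegenerate Tconf.

(** The intersection of the two triangles lies on a side of the first one,
    where a barycentric coordinate vanishes. *)
Lemma interior_disjoint K1 K2 x : K1 <> K2 ->
  (triangle K1)° x -> triangle K2 x -> False.
Proof.
move=> K12 x1 x2; have /(interior_triangleP nondeg) b1 := x1.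
have x12 : (triangle K1 `&` triangle K2) x by split=> //; exact: interior_subset.
case: (mesh_conforming Tconf K12).
- by move=> E; rewrite E in x12.
- move=> [i [j [_ E]]]; rewrite E in x12; have := b1 (i + 1).
  rewrite x12 bary_vtx // (_ : (i + 1 == i) = false) ?ltxx //.
  by rewrite -subr_eq0 addrAC subrr add0r.
- move=> [F [/edgesP[i ->] _ E]]; rewrite E in x12.
  by have := b1 i; rewrite (hull_edge_bary0 nondeg x12) ltxx.
Qed.

(** If both opposite vertices were on the same side, points near the midpoint
    of the edge would be interior to both triangles. *)
Lemma opposite_sides K1 K2 i1 i2 : K1 <> K2 -> edge K1 i1 = edge K2 i2 ->
  bary K2 i2 (pos (vtx K1 i1)) < 0.
Proof.
move=> K12 E; set v := pos _; rewrite ltNge; apply/negP => b0.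
have node1 j : j != i1 -> exists2 k, k != i2 & vtx K1 j = vtx K2 k.
  rewrite -(vtx_in_edge nondeg K1) E => /imsetP[k].
  by rewrite inE => k2 ->; exists k.
have node2 k : k != i2 -> exists2 j, j != i1 & vtx K2 k = vtx K1 j.
  rewrite -(vtx_in_edge nondeg K2) -E => /imsetP[j].
  by rewrite inE => j1 ->; exists j.
pose w j : R := if j == i1 then 0 else 1 / 2.
have w1 : \sum_j w j = 1.
  by rewrite /w sum_ord3; move: (i1); apply: ord3P => /=; lra.
(* the midpoint of the common edge *)
pose m := \sum_j w j *: pos (vtx K1 j).
have baryv k : bary K1 k v = (k == i1)%:R by rewrite bary_vtx.
have m1 k : bary K1 k m = w k by rewrite bary_comb.
have mE k : bary K2 k m = \sum_j w j * bary K2 k (pos (vtx K1 j)).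
  by rewrite (affine_comb _ (bary_affine K2 k)).
have m2 k : k != i2 -> 0 < bary K2 k m.
  move=> k2; have [j j1 kj] := node2 _ k2.
  rewrite mE (bigD1 j) //= -kj bary_vtx // eqxx mulr1 /w (negPf j1) ltr_pwDl //.
  apply: sumr_ge0 => l _; case: eqP => [_|/eqP l1]; first by rewrite mul0r.
  have [k' _ ->] := node1 _ l1.
  by rewrite bary_vtx // mulr_ge0 ?ler0n.
have m2i : bary K2 i2 m = 0.
  rewrite mE big1 // => j _; rewrite /w.
  case: eqP => [_|/eqP j1]; first by rewrite mul0r.
  have [k k2 ->] := node1 _ j1.
  by rewrite bary_vtx // eq_sym (negPf k2) mulr0.
have bv : 0 < bary K2 i2 v.
  rewrite lt_neqAle b0 andbT; apply/eqP => /esym v0.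
  have := baryv i1; rewrite eqxx [v in bary _ _ v](bary_pos nondeg K2).
  rewrite (affine_comb _ (bary_affine K1 i1)) ?bary_sum //.
  rewrite big1 => [/esym/eqP|j _]; first by rewrite oner_eq0.
  have [->|j2] := eqVneq j i2; first by rewrite v0 mul0r.
  have [k k1 ->] := node2 _ j2.
  by rewrite bary_vtx // eq_sym (negPf k1) mulr0.
(* small steps from m towards v stay in both open triangles *)
have near0 : \forall t \near (0 : R), forall k, k != i2 ->
    0 < bary K2 k (m + t *: (v - m)).
  apply: (@filter_forall _ _
    (fun k t => k != i2 -> 0 < bary K2 k (m + t *: (v - m))) (nbhs 0)) => k.
  case: (eqVneq k i2) => [->|k2].
    by apply: nearW => t; rewrite ?eqxx.
  apply: filterS (_ : \forall t \near (0 : R), 0 < bary K2 k (m + t *: (v - m))) => //.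
  have := continuous_comp (@line_continuous R m (v - m) 0)
    (@bary_continuous R T K2 k _).
  move/(_ [set t | 0 < t]); apply; apply: open_nbhs_nbhs; split; first exact: open_gt.
  by rewrite /= scale0r addr0; exact: m2.
have [t /andP[t0 t1] Ht] : exists2 t : R, 0 < t < 1 & forall k, k != i2 ->
    0 < bary K2 k (m + t *: (v - m)).
  have /nbhs_ballP[e /= e0 He] := near0.
  exists (Num.min (e / 2) (1 / 2)).
    by rewrite lt_min divr_gt0 //= gt_min; apply/andP; split; [|apply/orP; right]; lra.
  apply: He; rewrite /ball /= sub0r normrN ger0_norm ?le_min ?divr_ge0 ?ltW //.
  by rewrite gt_min ltr_pdivrMr // ltr_pMr // ltr1n.
apply: (@interior_disjoint K1 K2 (m + t *: (v - m))) => //.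
  apply/(interior_triangleP nondeg) => k.
  rewrite affine_line ?baryv ?m1; last exact: bary_affine.
  by rewrite /w; case: eqP => _ /=; lra.
apply/(triangleP nondeg) => k; have [->|k2] := eqVneq k i2; last exact/ltW/Ht.
rewrite affine_line ?m2i; last exact: bary_affine.
by rewrite mulr0 add0r mulr_ge0 // ltW.
Qed.

(** Both normals are unit vectors orthogonal to the edge, hence equal or
    opposite; equal ones would see the two opposite vertices on the same side. *)
Lemma outward_normals_cancel (nF : {set node T} -> R * R) F K1 K2 :
  unit_edge_normals nF -> F \in internal_edges -> K1 <> K2 ->
  F \in edges K1 -> F \in edges K2 ->
  dot (outward_normal K2 F) (nF F) = - dot (outward_normal K1 F) (nF F) /\
  dot (outward_normal K1 F) (nF F) != 0.
Proof.
move=> unF intF K12 /edgesP[i1 F1] /edgesP[i2 F2].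
have [nn nFe] := unF F intF.
have [n11 n1e n1v] := outward_normalP nondeg K1 i1.
have [n21 n2e n2v] := outward_normalP nondeg K2 i2.
move: n11 n1e n1v n21 n2e n2v; rewrite -F1 -F2.
set n1 := outward_normal K1 F; set n2 := outward_normal K2 F => n11 n1e n1v n21 n2e n2v.
pose k := vtx K1 (i1 + 1); pose l := vtx K1 (i1 + 2).
have kF : k \in F.
  rewrite F1 vtx_in_edge //; move: (i1); exact: ord3P.
have lF : l \in F.
  rewrite F1 vtx_in_edge //; move: (i1); exact: ord3P.
pose d := pos k - pos l.
have d0 : d != 0.
  apply: contraNneq (nondeg K1) => kl.
  rewrite -(cyclic_det K1 i1) -/k -/l (subr0_eq kl) /cross; apply/eqP; ring.
split; last first.
  have [->|->] := unit_normals_eq d0 n11 nn (n1e _ _ kF lF) (nFe _ _ kF lF).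
    by rewrite nn oner_eq0.
  by rewrite dotNl nn oppr_eq0 oner_eq0.
have [E|->] := unit_normals_eq d0 n21 n11 (n2e _ _ kF lF) (n1e _ _ kF lF); last first.
  exact: dotNl.
have E12 : edge K1 i1 = edge K2 i2 by rewrite -F1.
have := opposite_sides K12 E12; set beta := bary _ _ _ => beta0.
have : dot n2 (pos (vtx K1 i1) - pos k) = beta * dot n2 (pos (vtx K2 i2) - pos k).
  have s1 := bary_sum nondeg K2 (pos (vtx K1 i1)).
  have -> : pos (vtx K1 i1) - pos k =
      \sum_j bary K2 j (pos (vtx K1 i1)) *: (pos (vtx K2 j) - pos k).
    under eq_bigr do rewrite scalerBr.
    by rewrite sumrB -scaler_suml s1 scale1r -bary_pos.
  rewrite (big_morph (dot n2) (id1 := 0) (op1 := +%R)); first last.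
  - by rewrite /dot /= !mulr0 addr0.
  - by move=> x y; rewrite /dot /=; ring.
  have dotZ (c : R) x : dot n2 (c *: x) = c * dot n2 x.
    by rewrite scale_pairE /dot /=; ring.
  under eq_bigr do rewrite dotZ.
  rewrite (bigD1 i2) //= big1 ?addr0 // => j ji2.
  by rewrite n2e ?mulr0 // F2 vtx_in_edge.
rewrite E => n1k; have := n1v _ kF; rewrite n1k.
rewrite nmulr_llt0; first by move=> /(lt_trans beta0); rewrite ltxx.
by rewrite -E; exact: n2v.
Qed.

End Conforming.

(** * Null sets and traces *)

(** A boundary point has points outside the closure on the upper side of its
    chart, so it is not interior to the closure. This puts the open triangles
    inside the domain. *)
Lemma interior_closure_lipschitz (R : realType) (Omega : set (R * R)) :
  open Omega -> lipschitz_boundary Omega -> (closure Omega)° `<=` Omega.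
Proof.
move=> oO lipO x xc; apply: contrapT => nOx.
have bd y : closure Omega y -> ~ Omega y -> topological_boundary Omega y.
  by move=> cy nOy; split=> // /interior_subset.
have cx : closure Omega x by exact: interior_subset xc.
have [e [gamma [k [r [h [_ r0 h0 _ [_ chart]]]]]]] := lipO x (bd _ cx nOx).
have g0 : 0 = gamma 0.
  have := chart 0 0; rewrite !normr0 => /(_ r0 h0) [_ <-].
  by rewrite !scale0r !addr0; exact: bd.
have := @line_continuous R x (- e.2, e.1) 0.
rewrite /continuous_at scale0r addr0 => /(_ _ xc) /nbhs_ballP[d /= d0 Hd].
pose t := Num.min (d / 2) (h / 2).
have t0 : 0 < t by rewrite lt_min !divr_gt0.
have td : t < d by rewrite gt_min; apply/orP; left; lra.
have th : t < h by rewrite gt_min; apply/orP; right; lra.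
have cy : closure Omega (x + t *: (- e.2, e.1)).
  apply: Hd.
  by rewrite /ball /= sub0r normrN gtr0_norm.
have := chart 0 t; rewrite normr0 (gtr0_norm t0) => /(_ r0 th).
rewrite scale0r addr0 -g0 => -[/= inO inB].
have nO : ~ Omega (x + t *: (- e.2, e.1)) by rewrite inO ltNge (ltW t0).
by have /inB tE := bd _ cy nO; move: t0; rewrite tE ltxx.
Qed.

Section AreaMeasure.
Context {R : realType}.
Local Notation MR := (measurableTypeR R).
Local Notation mu := (@area_measure R).
Implicit Types (A D : set (R * R)) (f q u : R * R -> R).

(** The area measure lives on a product of two copies of the Borel line, a
    structure that a plain set of points does not determine; hence these
    restatements. *)
Lemma null_sub A D : D `<=` A -> mu.-negligible A -> mu.-negligible D.
Proof. exact: (@negligibleS _ (MR * MR)%type _ mu A D). Qed.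

Lemma null_union A D : mu.-negligible A -> mu.-negligible D ->
  mu.-negligible (A `|` D).
Proof. exact: (@negligibleU _ (MR * MR)%type _ mu A D). Qed.

Lemma ae_filter : Filter (almost_everywhere mu).
Proof. exact: (@ae_filter_ringOfSetsType _ (MR * MR)%type _ mu). Qed.

(** The plane has a countable base of rational boxes. *)
Lemma open_measurable_plane A : open A -> measurable (A : set (MR * MR)).
Proof.
move=> oA.
pose box (s : rat * rat * rat) : set (R * R) :=
  [set z | `|ratr s.1.1 - z.1| < ratr s.2 /\ `|ratr s.1.2 - z.2| < ratr s.2].
have mbox (s : rat * rat * rat) : measurable (box s : set (MR * MR)).
  have -> : box s = (ball (ratr s.1.1 : R) (ratr s.2) : set R) `*`
                    (ball (ratr s.1.2 : R) (ratr s.2) : set R) by [].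
  by apply: measurableX; exact: measurable_ball.
have -> : A = \bigcup_s (if `[< box s `<=` A >] then box s else set0).
  apply/seteqP; split=> [x Ax|x [s _]]; last by case: asboolP => // sA /sA.
  have /nbhs_ballP[e /= e0 He] : nbhs x A by exact: open_nbhs_nbhs.
  have [r] := @rat_in_itvoo R (e / 4) (e / 2) ltac:(lra).
  rewrite in_itv /= => /andP[r1 r2].
  have [a] := @rat_in_itvoo R (x.1 - e / 4) (x.1 + e / 4) ltac:(lra).
  rewrite in_itv /= => /andP[a1 a2].
  have [b] := @rat_in_itvoo R (x.2 - e / 4) (x.2 + e / 4) ltac:(lra).
  rewrite in_itv /= => /andP[b1 b2].
  exists ((a, b), r) => //; case: asboolP => [_|]; last first.
    case=> z [/= z1 z2]; apply: He; move: z1 z2; rewrite !ltr_norml => z1 z2.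
    by split; rewrite /ball /= ltr_norml; apply/andP; split; lra.
  by split; rewrite /= ltr_norml; apply/andP; split; lra.
apply: countable_bigcupT_measurable => // s.
by case: ifP.
Qed.

Lemma continuous_measurable_plane f : continuous f ->
  measurable_fun setT (f : MR * MR -> R).
Proof.
move=> /continuousP cf; apply: (measurability _ (RGenOpens.measurableE R)).
move=> _ [_ [a [b ->] <-]]; rewrite setTI; apply: open_measurable_plane.
exact/cf/interval_open.
Qed.

Lemma area_measureX (X Y : set MR) : measurable X -> measurable Y ->
  mu (X `*` Y) = (lebesgue_measure X * lebesgue_measure Y)%E.
Proof. exact: product_measure1E. Qed.

Lemma negligible_line f : affine_in fst snd f -> (exists x y, f x <> f y) ->
  mu.-negligible [set z | f z = 0].
Proof.
move=> af [x [y fxy]].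
have mA : measurable ([set z | f z = 0] : set (MR * MR)).
  have := continuous_measurable_plane (affine_continuous af).
  by move=> /(_ measurableT _ (measurable_set1 0)); rewrite setTI.
have [a [b [c fE]]] := af.
apply/negligibleP => //.
have [c0|c0] := eqVneq c 0.
  have b0 : b != 0.
    by apply: contra_notN fxy => /eqP b0; rewrite !fE c0 b0 !mul0r.
  have -> : [set z | f z = 0] = [set - a / b] `*` setT.
    apply/seteqP; split=> [z /=|z /= [z1 _]]; rewrite fE c0 mul0r addr0.
      by move=> abz; split=> //; apply: (mulIf b0); rewrite divfK //; lra.
    by rewrite z1; field.
  apply: etrans (area_measureX _ _) _ => //.
  by rewrite lebesgue_measure_set1 mul0e.
apply: integral0_eq => t _ /=.
have -> : xsection [set z | f z = 0] t = [set - (a + b * t) / c].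
  apply/seteqP; split=> [z /xsectionP /=|z /= ->]; last first.
    by apply/xsectionP; rewrite /= fE /=; field.
  by rewrite fE /= => abz; apply: (mulIf c0); rewrite divfK //; lra.
exact: lebesgue_measure_set1.
Qed.

Lemma open_not_negligible A : open A -> A !=set0 -> ~ mu.-negligible A.
Proof.
move=> oA [x Ax]; have /nbhs_ballP[e /= e0 He] : nbhs x A by exact: open_nbhs_nbhs.
have mb : measurable (ball x e : set (MR * MR)).
  by apply: open_measurable_plane; exact: ball_open.
move=> nA; have nb : mu.-negligible (ball x e).
  exact: null_sub He nA.
have := @measure_negligible _ (MR * MR)%type _ mu _ mb nb.
have -> : ball x e = (ball x.1 e : set R) `*` (ball x.2 e : set R) by [].
move=> /(etrans (esym (area_measureX (measurable_ball _ _) (measurable_ball _ _)))).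
rewrite !lebesgue_measure_ball ?ltW // -EFinM => /eqP; rewrite eqe.
by rewrite mulf_eq0 orbb mulrn_eq0 /= gt_eqF.
Qed.

Lemma ae_eq_restrict A D f u : A `<=` D -> ae_eq mu D f u -> ae_eq mu A f u.
Proof. exact: (@ae_eq_subset _ (MR * MR)%type _ _ mu D A). Qed.

Lemma ae_sym D f u : ae_eq mu D f u -> ae_eq mu D u f.
Proof. exact: (@ae_eq_sym _ (MR * MR)%type _ mu D). Qed.

Lemma ae_trans D f u g : ae_eq mu D f u -> ae_eq mu D u g -> ae_eq mu D f g.
Proof. exact: (@ae_eq_trans _ (MR * MR)%type _ mu D _ f u g). Qed.

Lemma ae_eqW D f u : (forall x, D x -> f x = u x) -> ae_eq mu D f u.
Proof. exact: (@aeW _ (MR * MR)%type _ mu). Qed.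

Lemma ae_eq_widen A D f u : mu.-negligible (D `\` A) ->
  ae_eq mu A f u -> ae_eq mu D f u.
Proof.
move=> nDA nA; apply: null_sub (null_union nDA nA) => x /= /not_implyP[Dx fu].
by have [Ax|nAx] := pselect (A x); [right=> /(_ Ax)|left].
Qed.

Lemma ae_eq_bigcup (I : finType) (A : I -> set (R * R)) f u :
  (forall i, ae_eq mu (A i) f u) -> ae_eq mu (\bigcup_i A i) f u.
Proof.
move=> H.
have := @filter_forall _ _ (fun i x => A i x -> f x = u x)
  (almost_everywhere mu) ae_filter H.
by apply: (@filterS _ (almost_everywhere mu) ae_filter) => x Hx [i _ /Hx].
Qed.

End AreaMeasure.

Section TriangleTraces.
Context {R : realType} {T : mesh R}.
Hypothesis nondegenerate : forall K : elt T,
  cross (pos (vtx K 1) - pos (vtx K 0)) (pos (vtx K 2) - pos (vtx K 0)) != 0.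
Local Notation mu := (@area_measure R).
Implicit Types (K : elt T) (u q : R * R -> R).

Lemma triangle_boundary_negligible K :
  mu.-negligible (triangle K `\` (triangle K)°).
Proof.
have bary_ae : \forall x \ae mu, forall i, bary K i x <> 0.
  apply: (@filter_forall _ _ (fun i x => bary K i x <> 0)
    (almost_everywhere mu) ae_filter).
  move=> i; apply: (@null_sub R [set x | bary K i x = 0]).
    by move=> x /= /contrapT.
  apply: negligible_line; first exact: bary_affine.
  exists (pos (vtx K i)), (pos (vtx K (i + 1))); rewrite !bary_vtx // eqxx.
  have -> : (i == i + 1) = false by move: i; exact: ord3P.
  exact/eqP/oner_neq0.
apply: null_sub bary_ae.
move=> x [/(triangleP nondegenerate) x0 nx].
have [i bi] : exists i, bary K i x = 0.
  apply: contrapT => /forallNP xi; apply: nx.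
  apply/(interior_triangleP nondegenerate) => i.
  by rewrite lt_neqAle x0 andbT eq_sym; apply/eqP.
by move=> /(_ i); rewrite bi.
Qed.

Lemma ae_eq_triangle K u q :
  ae_eq mu (triangle K)° u q <-> ae_eq mu (triangle K) u q.
Proof.
split; first by apply: ae_eq_widen; exact: triangle_boundary_negligible.
by move=> uq; apply: ae_eq_restrict uq; exact: interior_subset.
Qed.

(** If the two functions differed at a point, they would differ, by continuity,
    on the points of the open triangle near it, a nonempty open set. *)
Lemma ae_eq_continuous_triangle K u q x : {within triangle K, continuous u} ->
  {within triangle K, continuous q} -> ae_eq mu (triangle K) u q ->
  triangle K x -> u x = q x.
Proof.
move=> cu cq uq Kx; apply: contrapT => nuq.
have Kc : (triangle K)° (centroid K) by exact: centroid_interior.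
pose d := u \- q.
have cd : {within triangle K, continuous d}.
  by move=> y; apply: cvgB; [exact: cu|exact: cq].
have dx : d x != 0 by rewrite subr_eq0; apply/eqP.
have : nbhs_subspace (x : subspace (triangle K)) (d @^-1` [set t | t != 0]).
  by apply: cd; apply: open_nbhs_nbhs; split; first exact: open_neq.
rewrite -nbhs_subspace_in // => near_x.
have /nbhs_ballP[e /= e0 He] := near_x.
have := @line_continuous R x (centroid K - x) 0.
rewrite /continuous_at scale0r addr0 => /(_ (ball x e) (nbhsx_ballx _ _ e0)).
move=> /nbhs_ballP[r /= r0 Hr].
pose t := Num.min (r / 2) 1.
have t0 : 0 < t by rewrite lt_min divr_gt0 //=.
have tr : t < r by rewrite gt_min; apply/orP; left; lra.
have t1 : t <= 1 by rewrite ge_min lexx orbT.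
pose y := x + t *: (centroid K - x).
have yK : (triangle K)° y by apply: line_to_centroid_interior => //; rewrite t0.
have ye : ball x e y by apply: Hr; rewrite /ball /= sub0r normrN gtr0_norm.
apply: (@open_not_negligible R ((triangle K)° `&` ball x e)).
- by apply: openI; [exact: open_interior|exact: ball_open].
- by exists y.
- apply: null_sub uq => z [/interior_subset zK ze] /= /(_ zK) uqz.
  by have := He z ze zK; rewrite /= /d /= uqz subrr eqxx.
Qed.

Lemma continuous_rep_triangle K u q x : continuous q ->
  ae_eq mu (triangle K) u q -> triangle K x ->
  continuous_rep (triangle K) u x = q x.
Proof.
move=> cq uq Kx; rewrite /continuous_rep; set S := [set w | _].
have [cw uw] : S (get S).
  by apply: getPex; exists q; split=> //; exact: continuous_subspaceT.
apply: ae_eq_continuous_triangle Kx => //; first exact: continuous_subspaceT.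
exact: ae_trans (ae_sym uw) uq.
Qed.

End TriangleTraces.

(** * Weak derivatives of polynomials *)

Section PartialDerivatives.
Context {R : realType}.
Implicit Types (f q g phi : R * R -> R).

Lemma plane_poly_partial1 n q : plane_poly fst snd n q ->
  exists2 g : R * R -> R, plane_poly fst snd n g &
    forall x y : R, is_derive x 1 (fun t => q (t, y)) (g (x, y)).
Proof.
have [Q0 QD QZ] := @plane_poly_closed R fst snd n.
apply: (plane_poly_class_ind
  (Q := fun q => exists2 g : R * R -> R, plane_poly fst snd n g &
    forall x y : R, is_derive x 1 (fun t => q (t, y)) (g (x, y)))).
  split.
  - by exists (fun=> 0) => // x y; exact: is_derive_cst.
  - move=> u v [u' Pu' du] [v' Pv' dv]; exists (fun z => u' z + v' z); first exact: QD.
    by move=> x y; apply: is_deriveD.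
  - move=> c u [u' Pu' du]; exists (fun z => c * u' z); first exact: QZ.
    by move=> x y; apply: is_deriveZ.
move=> i j ij; exists (fun z => i%:R * (z.1 ^+ i.-1 * z.2 ^+ j)).
  apply: QZ; apply: plane_poly_monomial;
    [exact: affine_in_fst|exact: affine_in_snd|lia].
move=> x y /=.
have := is_derive_poly ((y ^+ j) *: 'X^i) x.
rewrite (_ : horner _ = fun t => t ^+ i * y ^+ j); last first.
  by apply/funext => t; rewrite hornerZ hornerXn mulrC.
by rewrite derivZ derivXn hornerZ hornerMn hornerXn -mulr_natl mulrC -mulrA.
Qed.

Lemma plane_poly_partial2 n q : plane_poly fst snd n q ->
  exists2 g : R * R -> R, plane_poly fst snd n g &
    forall x y : R, is_derive y 1 (fun t => q (x, t)) (g (x, y)).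
Proof.
have [Q0 QD QZ] := @plane_poly_closed R fst snd n.
apply: (plane_poly_class_ind
  (Q := fun q => exists2 g : R * R -> R, plane_poly fst snd n g &
    forall x y : R, is_derive y 1 (fun t => q (x, t)) (g (x, y)))).
  split.
  - by exists (fun=> 0) => // x y; exact: is_derive_cst.
  - move=> u v [u' Pu' du] [v' Pv' dv]; exists (fun z => u' z + v' z); first exact: QD.
    by move=> x y; apply: is_deriveD.
  - move=> c u [u' Pu' du]; exists (fun z => c * u' z); first exact: QZ.
    by move=> x y; apply: is_deriveZ.
move=> i j ij; exists (fun z => j%:R * (z.1 ^+ i * z.2 ^+ j.-1)).
  apply: QZ; apply: plane_poly_monomial;
    [exact: affine_in_fst|exact: affine_in_snd|lia].
move=> x y /=.
have := is_derive_poly ((x ^+ i) *: 'X^j) y.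
rewrite (_ : horner _ = fun t => x ^+ i * t ^+ j); last first.
  by apply/funext => t; rewrite hornerZ hornerXn.
by rewrite derivZ derivXn hornerZ hornerMn hornerXn -mulr_natl mulrCA.
Qed.

Lemma plane_poly_bounded n f (M : R) : plane_poly fst snd n f ->
  exists B, forall z, `|z.1| <= M -> `|z.2| <= M -> `|f z| <= B.
Proof.
apply: (plane_poly_class_ind (Q := fun f => exists B, forall z : R * R,
  `|z.1| <= M -> `|z.2| <= M -> `|f z| <= B)).
  split.
  - by exists 0 => z _ _; rewrite normr0.
  - move=> u v [B uB] [C vC]; exists (B + C) => z z1 z2.
    by rewrite (le_trans (ler_normD _ _)) // lerD ?uB ?vC.
  - move=> c u [B uB]; exists (`|c| * B) => z z1 z2.
    by rewrite normrM ler_wpM2l // uB.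
move=> i j _; exists (M ^+ i * M ^+ j) => z z1 z2.
by rewrite normrM !normrX ler_pM ?exprn_ge0 // lerXn2r ?nnegrE //;
  apply: le_trans (normr_ge0 _) _; eassumption.
Qed.

Lemma slice_derive1 phi x y : derivable phi (x, y) (1, 0) ->
  is_derive x 1 (fun t => phi (t, y)) ('D_(1, 0) phi (x, y)).
Proof.
move=> dphi.
have E : (fun h : R => h^-1 *:
      (((fun t => phi (t, y)) \o shift x) (h *: (1 : R)) - phi (x, y))) =
    (fun h : R => h^-1 *: ((phi \o shift (x, y)) (h *: ((1, 0) : R * R)) - phi (x, y))).
  apply/funext => h /=; congr (_ *: (phi _ - _)).
  by rewrite scale_pairE /=; congr pair; rewrite /= mulr0 add0r.
by split; [rewrite /derivable E|rewrite /derive E].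
Qed.

Lemma slice_derive2 phi x y : derivable phi (x, y) (0, 1) ->
  is_derive y 1 (fun t => phi (x, t)) ('D_(0, 1) phi (x, y)).
Proof.
move=> dphi.
have E : (fun h : R => h^-1 *:
      (((fun t => phi (x, t)) \o shift y) (h *: (1 : R)) - phi (x, y))) =
    (fun h : R => h^-1 *: ((phi \o shift (x, y)) (h *: ((0, 1) : R * R)) - phi (x, y))).
  apply/funext => h /=; congr (_ *: (phi _ - _)).
  by rewrite scale_pairE /=; congr pair; rewrite /= mulr0 add0r.
by split; [rewrite /derivable E|rewrite /derive E].
Qed.

(** The primitive vanishes at both ends of an interval outside which the
    integrand is zero. *)
Lemma slice_integral0 (F h : R -> R) (M : R) : 0 < M ->
  (forall t : R, is_derive t 1 F (h t)) -> continuous h ->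
  (forall t, M <= `|t| -> F t = 0 /\ h t = 0) ->
  (\int[@lebesgue_measure R]_t (h t)%:E = 0)%E.
Proof.
move=> M0 dF ch zero.
have -> : (\int[@lebesgue_measure R]_t (h t)%:E =
    \int[@lebesgue_measure R]_(t in `[(- M)%R, M%R]) (h t)%:E)%E.
  rewrite [RHS]integral_mkcond; apply: eq_integral => t _.
  rewrite patchE; case: ifPn => //; rewrite notin_setE /= in_itv /= => nt.
  have Mt : M <= `|t|.
    by rewrite leNgt ltr_norml; apply: contra_notN nt => /andP[t1 t2]; rewrite !ltW.
  by have [_ ->] := zero t Mt.
have cF : continuous F.
  move=> t; apply: differentiable_continuous; apply/derivable1_diffP.
  by have [] := dF t.
rewrite (@continuous_FTC2 R h F) //.
- have [-> _] := zero M (ler_norm M).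
  have NM : M <= `|- M| by rewrite normrN ler_norm.
  have [-> _] := zero _ NM.
  by rewrite subee.
- lra.
- exact: continuous_subspaceT.
- split; first by move=> t _; have [] := dF t.
  + exact/cvg_at_right_filter/cF.
  + exact/cvg_at_left_filter/cF.
- by move=> t _; rewrite derive1E; have [_ ->] := dF t.
Qed.

End PartialDerivatives.

Section SquareIntegrable.
Context {R : realType}.
Local Notation MR := (measurableTypeR R).
Local Notation mu := (@area_measure R).
Local Notation leb := (@lebesgue_measure R).
Implicit Types (A D Omega : set (R * R)) (f q u v g phi : R * R -> R).

Lemma L2_of_sqr_integrable f : measurable_fun setT (f : MR * MR -> R) ->
  mu.-integrable setT (EFin \o (fun x => f x ^+ 2)) -> f \in Lfun mu 2%:E.
Proof.
move=> mf /integrableP[_ fi]; rewrite inE; apply/andP; split; rewrite inE //=.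
rewrite /finite_norm unlock /=; apply: poweR_lty.
apply: le_lt_trans fi; apply: ge0_le_integral => //=.
- apply/measurable_EFinP.
  apply/(@measurableT_comp _ _ _ _ _ _ (fun x : R => x `^ 2)%R) => //.
  exact/measurableT_comp.
- apply/measurable_EFinP; apply: measurableT_comp => //; exact: measurable_funX.
- by move=> x _; rewrite lee_fin normrX powR_mulrn.
Qed.

Lemma L2_restrict A D v : open D -> D `<=` A -> L2 A v -> L2 D v.
Proof.
move=> oD DA vA.
have mD : measurable (D : set (MR * MR)) by exact: open_measurable_plane.
have vD : v \_ D = (v \_ A) \_ D.
  apply/funext => x; rewrite !patchE; case: ifPn => // xD.
  by rewrite mem_set //; apply: DA; rewrite -in_setE.
have mvA : measurable_fun setT (v \_ A : MR * MR -> R).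
  by move: vA; rewrite /L2 inE => /andP[]; rewrite inE.
have mvD : measurable_fun setT (v \_ D : MR * MR -> R).
  by rewrite vD; apply: (measurable_restrictT _ mD).1; exact: measurable_funTS.
apply: L2_of_sqr_integrable => //.
apply: (le_integrable measurableT _ _ (Lfun2_integrable_sqr vA)).
  by apply/measurable_EFinP; exact: measurable_funX.
move=> x _ /=; rewrite lee_fin vD [(_ \_ D) x]patchE; case: ifP => // _.
by rewrite expr0n normr0.
Qed.

Lemma L2_measurable D v : measurable (D : set (MR * MR)) -> L2 D v ->
  measurable_fun D (v : MR * MR -> R).
Proof.
move=> mD; rewrite /L2 inE => /andP[]; rewrite inE => mv _.
exact: (measurable_restrictT _ mD).2.
Qed.

Variables (D : set (R * R)) (M : R).
Hypotheses (oD : open D) (DM : forall z, D z -> `|z.1| < M /\ `|z.2| < M).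

Let mD : measurable (D : set (MR * MR)) := open_measurable_plane oD.

Lemma area_bounded_finite : (mu D < +oo)%E.
Proof.
pose N := `|M| + 1; have MN : M <= N by rewrite (le_trans (ler_norm M)) // lerDl.
have mB := @measurable_ball R 0 N.
apply: (@le_lt_trans _ _ (mu ((ball 0 N : set R) `*` (ball 0 N : set R)))).
  apply: le_measure; rewrite ?inE //; first exact: measurableX.
  by move=> z /DM[z1 z2]; split; rewrite /ball /= sub0r normrN (lt_le_trans _ MN).
have -> := area_measureX mB mB.
by rewrite !lebesgue_measure_ball ?addr_ge0 // -EFinM ltry.
Qed.

Lemma bounded_integrable f : measurable_fun setT (f : MR * MR -> R) ->
  (exists B, forall z, D z -> `|f z| <= B) -> mu.-integrable D (EFin \o f).
Proof.
move=> mf [B fB]; apply: measurable_bounded_integrable => //.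
- exact: area_bounded_finite.
- exact: measurable_funTS.
- exists B; split; first exact: num_real.
  by move=> C BC z Dz; exact: le_trans (fB z Dz) (ltW BC).
Qed.

Lemma plane_poly_bounded_on n f : plane_poly fst snd n f ->
  exists B, forall z, D z -> `|f z| <= B.
Proof.
move=> /(plane_poly_bounded M)[B fB]; exists B => z /DM[z1 z2].
by apply: fB; exact: ltW.
Qed.

Lemma L2_plane_poly n f : plane_poly fst snd n f -> L2 D f.
Proof.
move=> Pf; have mf := continuous_measurable_plane (plane_poly_continuous Pf).
have [B fB] := plane_poly_bounded_on Pf.
apply: L2_of_sqr_integrable.
  by apply: (measurable_restrictT _ mD).1; exact: measurable_funTS.
have -> : EFin \o (fun x => (f \_ D) x ^+ 2) = (EFin \o (fun x => f x ^+ 2)) \_ D.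
  apply/funext => x; rewrite /= !patchE; case: ifP => // _.
  by rewrite expr0n.
apply: (integrable_mkcond _ mD).1; apply: bounded_integrable.
  exact: measurable_funX.
exists (B ^+ 2) => z Dz.
by rewrite normrX lerXn2r ?nnegrE ?fB // (le_trans _ (fB z Dz)).
Qed.

(** Integration by parts needs no boundary term because the test function
    vanishes near the boundary. It remains to know that the derivative of the
    product integrates to zero, which depends on the direction. *)
Lemma weak_derivative_of_total e n q g v : plane_poly fst snd n q ->
  plane_poly fst snd n g -> L2 D v -> ae_eq mu D v q ->
  (forall phi, test_function D phi -> forall h : R * R -> R,
     h = (fun x => q x * 'D_e phi x + g x * phi x) ->
     mu.-integrable setT (EFin \o h) -> (forall x, ~ D x -> h x = 0) ->
     (\int[mu]_x (h x)%:E = 0)%E) ->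
  weak_derivative D e v g.
Proof.
move=> Pq Pg L2v vq total phi tphi; have [sm [C [cC CD phi0]]] := tphi.
have cphi : continuous phi by have [] := sm [::].
have cdphi : continuous ('D_e phi) by have [] := sm [:: e].
have mphi := continuous_measurable_plane cphi.
have mdphi := continuous_measurable_plane cdphi.
have mq := continuous_measurable_plane (plane_poly_continuous Pq).
have mg := continuous_measurable_plane (plane_poly_continuous Pg).
have closedC : closed C by apply: compact_closed => //; exact: norm_hausdorff.
have dphi0 x : ~ C x -> 'D_e phi x = 0.
  move=> nCx; have -> : 'D_e phi x = 'D_e (cst 0 : R * R -> R) x.
    apply: near_eq_derive.
    have oC : open (~` C) by exact: closed_openC.
    by apply: filterS (open_nbhs_nbhs (conj oC nCx)) => y nCy; rewrite phi0.
  exact: derive_cst.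
have bd (f : R * R -> R) : continuous f -> (forall x, ~ C x -> f x = 0) ->
    exists B, forall z, `|f z| <= B.
  move=> cf f0; have : compact (f @` C).
    by apply: continuous_compact => //; exact: continuous_subspaceT.
  move=> /compact_bounded[B [_ HB]]; exists (`|B| + 1) => z.
  have [Cz|nCz] := pselect (C z); last by rewrite f0 // normr0 addr_ge0.
  apply: HB; last by exists z.
  by rewrite (le_lt_trans (ler_norm B)) // ltrDl.
have bdM (f u : R * R -> R) : (exists B, forall z, D z -> `|f z| <= B) ->
    (exists B, forall z, `|u z| <= B) -> exists B, forall z, D z -> `|f z * u z| <= B.
  move=> [B fB] [B' uB]; exists (B * B') => z Dz.
  by rewrite normrM ler_pM ?fB ?uB.
have iq : mu.-integrable D (EFin \o (fun x => q x * 'D_e phi x)).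
  apply: bounded_integrable; first exact: measurable_funM.
  by apply: bdM; [exact: plane_poly_bounded_on Pq|exact: bd].
have ig : mu.-integrable D (EFin \o (fun x => g x * phi x)).
  apply: bounded_integrable; first exact: measurable_funM.
  by apply: bdM; [exact: plane_poly_bounded_on Pg|exact: bd].
have -> : \int[mu]_(x in D) (v x * 'D_e phi x) = \int[mu]_(x in D) (q x * 'D_e phi x).
  congr fine; apply: ae_eq_integral => //.
  - apply/measurable_EFinP; apply: measurable_funM; first exact: L2_measurable.
    exact: measurable_funTS.
  - by apply/measurable_EFinP; apply: measurable_funTS; exact: measurable_funM.
  - apply: (@filterS _ (almost_everywhere mu) ae_filter) vq => x vq Dx.
    by rewrite vq.
apply/eqP; rewrite -addr_eq0 -RintegralD //; apply/eqP.
pose h (x : R * R) : R := q x * 'D_e phi x + g x * phi x.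
have h0 x : ~ D x -> h x = 0.
  move=> nDx; have nCx : ~ C x := fun Cx => nDx (CD _ Cx).
  by rewrite /h dphi0 // phi0 // !mulr0 addr0.
have hE : (EFin \o h) \_ D = EFin \o h.
  apply/funext => x; rewrite patchE /=; case: ifPn => // /negP nDx.
  by rewrite h0 // => Dx; apply: nDx; rewrite in_setE.
have ih : mu.-integrable setT (EFin \o h).
  rewrite -hE; apply: (integrable_mkcond _ mD).1.
  have -> : EFin \o h = (EFin \o (fun x => q x * 'D_e phi x)) \+
    (EFin \o (fun x => g x * phi x)) by [].
  exact: integrableD.
rewrite /Rintegral integral_mkcond hE.
by rewrite (total phi tphi h).
Qed.

Lemma test_function_slices phi : test_function D phi ->
  [/\ continuous phi, forall e, continuous ('D_e phi) &
      forall x e, derivable phi x e].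
Proof.
move=> [sm _]; split; first by have [] := sm [::].
  by move=> e; have [] := sm [:: e].
by move=> x e; have [_] := sm [::]; exact.
Qed.

Lemma slice1_continuous f y : continuous f -> continuous (fun t : R => f (t, y)).
Proof.
move=> cf.
have -> : (fun t : R => f (t, y)) = f \o (fun t : R => (0, y) + t *: (1, 0)).
  apply/funext => t /=; rewrite scale_pairE /= mulr1 mulr0.
  by congr f; congr pair; rewrite /= ?add0r ?addr0.
by move=> t; apply: continuous_comp; [exact: line_continuous|exact: cf].
Qed.

Lemma slice2_continuous f x : continuous f -> continuous (fun t : R => f (x, t)).
Proof.
move=> cf.
have -> : (fun t : R => f (x, t)) = f \o (fun t : R => (x, 0) + t *: (0, 1)).
  apply/funext => t /=; rewrite scale_pairE /= mulr1 mulr0.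
  by congr f; congr pair; rewrite /= ?add0r ?addr0.
by move=> t; apply: continuous_comp; [exact: line_continuous|exact: cf].
Qed.

Lemma continuous_product_derivative q g phi e : continuous q -> continuous g ->
  continuous phi -> continuous ('D_e phi) ->
  continuous (fun x => q x * 'D_e phi x + g x * phi x).
Proof.
move=> cq cg cphi cd x; apply: cvgD; apply: cvgM;
  [exact: cq|exact: cd|exact: cg|exact: cphi].
Qed.

(** The derivative along the first axis integrates to zero on each horizontal
    line, so the total integral vanishes by Fubini's theorem. *)
Lemma weak_derivative1 n q v : 0 < M -> plane_poly fst snd n q -> L2 D v ->
  ae_eq mu D v q -> exists2 g, L2 D g & weak_derivative D (1, 0) v g.
Proof.
move=> M0 Pq L2v vq; have [g Pg dq] := plane_poly_partial1 Pq.
exists g; first exact: L2_plane_poly Pg.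
have cq := plane_poly_continuous Pq; have cg := plane_poly_continuous Pg.
apply: weak_derivative_of_total Pq Pg L2v vq _ => phi tphi h hE ih h0.
have [cphi cdphi dphi] := test_function_slices tphi.
have [_ [C [_ CD phi0]]] := tphi.
rewrite -(integral21_prod_meas1 ih); apply: integral0_eq => y _.
apply: (@slice_integral0 R (fun t => q (t, y) * phi (t, y)) _ M) => //.
- move=> t; rewrite hE.
  have := is_deriveM (dq t y) (slice_derive1 (dphi (t, y) (1, 0))).
  by rewrite /GRing.scale /= [phi _ * _]mulrC.
- rewrite hE.
  apply: (@slice1_continuous (fun x => q x * 'D_(1, 0) phi x + g x * phi x)).
  exact: continuous_product_derivative.
- move=> t Mt; have nD : ~ D (t, y) by move=> /DM[/=]; rewrite ltNge Mt.
  by rewrite h0 // phi0 ?mulr0 // => /CD.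
Qed.

Lemma weak_derivative2 n q v : 0 < M -> plane_poly fst snd n q -> L2 D v ->
  ae_eq mu D v q -> exists2 g, L2 D g & weak_derivative D (0, 1) v g.
Proof.
move=> M0 Pq L2v vq; have [g Pg dq] := plane_poly_partial2 Pq.
exists g; first exact: L2_plane_poly Pg.
have cq := plane_poly_continuous Pq; have cg := plane_poly_continuous Pg.
apply: weak_derivative_of_total Pq Pg L2v vq _ => phi tphi h hE ih h0.
have [cphi cdphi dphi] := test_function_slices tphi.
have [_ [C [_ CD phi0]]] := tphi.
rewrite -(integral12_prod_meas1 ih); apply: integral0_eq => x _.
apply: (@slice_integral0 R (fun t => q (x, t) * phi (x, t)) _ M) => //.
- move=> t; rewrite hE.
  have := is_deriveM (dq x t) (slice_derive2 (dphi (x, t) (0, 1))).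
  by rewrite /GRing.scale /= [phi _ * _]mulrC.
- rewrite hE.
  apply: (@slice2_continuous (fun x => q x * 'D_(0, 1) phi x + g x * phi x)).
  exact: continuous_product_derivative.
- move=> t Mt; have nD : ~ D (x, t) by move=> /DM[_ /=]; rewrite ltNge Mt.
  by rewrite h0 // phi0 ?mulr0 // => /CD.
Qed.

Lemma H1_of_poly n q v : 0 < M -> plane_poly fst snd n q -> L2 D v ->
  ae_eq mu D v q -> H1 D v.
Proof.
move=> M0 Pq L2v vq.
have [g1 L1 w1] := weak_derivative1 M0 Pq L2v vq.
have [g2 L2' w2] := weak_derivative2 M0 Pq L2v vq.
by split=> //; exists g1, g2.
Qed.

End SquareIntegrable.

(** * Polynomials on an edge *)

Section EdgeExpansion.
Context {R : realType}.
Implicit Types (r s : {poly R}).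

Definition modal_coef (j : nat) : R := 8 * Num.sqrt (4 * j + 2)%:R / (j * (j + 1))%:R.

Lemma modal_coef_neq0 j : (0 < j)%N -> modal_coef j != 0.
Proof.
move=> j0; apply: mulf_neq0; last by rewrite invr_eq0 pnatr_eq0; lia.
apply: mulf_neq0; first by rewrite pnatr_eq0.
by rewrite gt_eqF // sqrtr_gt0 ltr0n; lia.
Qed.

Definition to_pm1 : {poly R} := 2%:P * 'X - 1.

Lemma horner_to_pm1 r t : (r \Po to_pm1).[t] = r.[2 * t - 1].
Proof. by rewrite horner_comp !hornerE. Qed.

Lemma size_comp_to_pm1 r : size (r \Po to_pm1) = size r.
Proof.
apply: size_comp_poly2; rewrite /to_pm1 mul_polyC size_polyDl.
  by rewrite size_scale ?size_polyX ?pnatr_eq0.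
by rewrite size_scale ?size_polyX ?pnatr_eq0 // size_polyN size_poly1.
Qed.

Lemma poly_vanishing_ends n r : (size r <= n.+2)%N -> r.[0] = 0 -> r.[1] = 0 ->
  exists2 s : {poly R}, (size s <= n)%N & forall t, r.[t] = (1 - t) * t * s.[t].
Proof.
move=> sr r0 r1.
have [r0'|r0'] := eqVneq r 0.
  by exists 0 => [|t]; rewrite ?size_poly0 // r0' !horner0 mulr0.
have /factor_theorem[u ru] : root r 0 by apply/rootP.
have u1 : u.[1] = 0.
  by move: r1; rewrite ru hornerM hornerXsubC subr0 mulr1.
have /factor_theorem[s us] : root u 1 by apply/rootP.
exists (- s); last first.
  by move=> t; rewrite ru us !hornerM !hornerXsubC hornerN; ring.
have s0 : s != 0 by apply: contraNneq r0' => s0; rewrite ru us s0 !mul0r.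
move: sr; rewrite ru us size_polyN size_Mmonic ?monicXsubC //; last first.
  by rewrite mulf_neq0 ?polyXsubC_eq0.
rewrite size_Mmonic ?monicXsubC // !size_XsubC.
by move: (size s) => k; rewrite !addnS !addn0.
Qed.

(** The edge modal functions restricted to their edge span the polynomials
    vanishing at both endpoints, because the derivatives of the Legendre
    polynomials have consecutive degrees. *)
Lemma edge_modal_expansion p r : (1 < p)%N -> (size r <= p.+1)%N ->
  r.[0] = 0 -> r.[1] = 0 -> exists d : nat -> R, forall t,
  r.[t] = \sum_(j < p | (0 < j)%N)
    d j * (modal_coef j * (1 - t) * t * ((legendre j)^`()).[2 * t - 1]).
Proof.
move=> p1 sr r0 r1.
have [n pn] : exists n, p = n.+1 by exists p.-1; rewrite prednK // ltnW.
have [s ss rE] : exists2 s : {poly R}, (size s <= n)%N &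
    forall t, r.[t] = (1 - t) * t * s.[t].
  by apply: poly_vanishing_ends; rewrite -?pn.
pose B j := modal_coef j.+1 *: ((legendre j.+1)^`() \Po to_pm1).
have sB j : size (B j) = j.+1.
  rewrite size_scale ?modal_coef_neq0 // size_comp_to_pm1.
  by rewrite size_deriv_char0 size_legendre.
have [c sE] := triangular_span sB ss.
exists (fun j => c j.-1) => t; rewrite rE sE horner_sum mulr_sumr pn.
rewrite [RHS]big_mkcond big_ord_recl /= add0r; apply: eq_bigr => i _.
by rewrite !hornerZ horner_to_pm1; ring.
Qed.

(** Subtracting the mean of the end values, then half their difference times the
    odd polynomial of degree [p - 1], makes both end values vanish. *)
Lemma edge_expansion p r : (0 < p)%N -> ~~ odd p -> (size r <= p.+1)%N ->
  exists d : nat -> R, forall t, r.[t] = (r.[0] + r.[1]) / 2 +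
    (r.[1] - r.[0]) / 2 * (legendre (p - 1)).[2 * t - 1] +
    \sum_(j < p | (0 < j)%N)
      d j * (modal_coef j * (1 - t) * t * ((legendre j)^`()).[2 * t - 1]).
Proof.
move=> p0 p_even sr; have p1 : (1 < p)%N by case: p p0 p_even {sr} => [|[]].
pose L : {poly R} := legendre (p - 1) \Po to_pm1.
pose u := r - ((r.[0] + r.[1]) / 2)%:P - ((r.[1] - r.[0]) / 2) *: L.
have uE t : u.[t] = r.[t] - (r.[0] + r.[1]) / 2 -
    (r.[1] - r.[0]) / 2 * (legendre (p - 1)).[2 * t - 1].
  by rewrite /u !hornerD !hornerN hornerC hornerZ horner_to_pm1.
have e1 : 2 * 1 - 1 = 1 :> R by ring.
have e0 : 2 * 0 - 1 = -1 :> R by ring.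
have su : (size u <= p.+1)%N.
  rewrite /u (leq_trans (size_polyD _ _)) // geq_max size_polyN; apply/andP; split.
    rewrite (leq_trans (size_polyD _ _)) // geq_max sr size_polyN.
    exact: leq_trans (size_polyC_leq1 _) _.
  rewrite (leq_trans (size_scale_leq _ _)) // size_comp_to_pm1 size_legendre; lia.
have odd1 : odd (p - 1) by rewrite oddB // (negPf p_even).
have u0 : u.[0] = 0.
  rewrite uE e0 legendreN1 -signr_odd odd1 expr1; lra.
have u1 : u.[1] = 0.
  rewrite uE e1 legendre1; lra.
have [d dE] := edge_modal_expansion p1 su u0 u1.
by exists d => t; rewrite -dE uE; ring.
Qed.

End EdgeExpansion.

(** * The explicit space as a space of families *)

Section Families.
Context {R : realType} {T : mesh R}.
Hypothesis nondeg : forall K : elt T,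
  cross (pos (vtx K 1) - pos (vtx K 0)) (pos (vtx K 2) - pos (vtx K 0)) != 0.
Variable ends : {set node T} -> node T * node T.
Hypothesis endsP : edge_orientation ends.
Variable p : nat.
Hypotheses (p_gt0 : (0 < p)%N) (p_even : ~~ odd p).
Implicit Types (K : elt T) (F : {set node T}) (G Q : elt T -> R * R -> R).
Implicit Types (i j k : 'I_3) (x : R * R) (t : R).

Definition edge_point F t : R * R :=
  pos (ends F).1 + t *: (pos (ends F).2 - pos (ends F).1).

(** What the moment conditions leave: jumps that are multiples of the one
    Legendre polynomial against which they are not tested. *)
Definition nonconforming_family Q :=
  (forall K, plane_poly fst snd p.+1 (Q K)) /\
  forall F K1 K2, K1 <> K2 -> F \in edges K1 -> F \in edges K2 ->
    exists a, forall t, Q K1 (edge_point F t) - Q K2 (edge_point F t) =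
      a * (legendre (p - 1)).[2 * t - 1].

Lemma edges_mesh_edges K F : F \in edges K -> F \in mesh_edges.
Proof. by move=> FK; apply/bigcupP; exists K. Qed.

Lemma edge_endsP K F : F \in edges K -> exists i j k,
  [/\ F = edge K k, (ends F).1 = vtx K i, (ends F).2 = vtx K j &
      [/\ i != k, j != k, i != j & forall l, [|| l == i, l == j | l == k]]].
Proof.
move=> FK; have FE := endsP (edges_mesh_edges FK).
have [k Fk] := edgesP FK.
have end_vtx n : n \in F -> exists2 i, i != k & n = vtx K i.
  by rewrite Fk => /imsetP[i]; rewrite inE => ik ->; exists i.
have [i ik i1] : exists2 i, i != k & (ends F).1 = vtx K i.
  by apply: end_vtx; rewrite {2}FE !inE eqxx.
have [j jk j1] : exists2 j, j != k & (ends F).2 = vtx K j.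
  by apply: end_vtx; rewrite {2}FE !inE eqxx orbT.
have ij : i != j.
  apply/eqP => ij; have [l lk lj] : exists2 l, l != k & l != j.
    move: k j jk {Fk end_vtx ik i1 j1 ij}; apply: ord3P; apply: ord3P => // _;
    by [exists 0|exists 1|exists 2].
  have : vtx K l \in F by rewrite Fk vtx_in_edge.
  by rewrite FE i1 j1 ij !inE orbb => /eqP /(vtx_inj nondeg) E; rewrite E eqxx in lj.
exists i, j, k; split=> //; split=> //.
move: i j k ij ik jk {Fk i1 j1 end_vtx}.
by do 3! apply: ord3P => //; move=> _ _ _; apply: ord3P.
Qed.

Lemma bary_edge_point K F i j k t : F = edge K k -> (ends F).1 = vtx K i ->
  (ends F).2 = vtx K j -> i != k -> j != k -> i != j ->
  [/\ bary K i (edge_point F t) = 1 - t, bary K j (edge_point F t) = t &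
      bary K k (edge_point F t) = 0].
Proof.
move=> _ i1 j1 ik jk ij.
rewrite /edge_point i1 j1 !affine_line; [|exact: bary_affine..].
rewrite !bary_vtx // !eqxx (negPf ij) [j == i]eq_sym (negPf ij).
rewrite ![k == _]eq_sym (negPf ik) (negPf jk); split => /=; ring.
Qed.

Lemma edge_point_bary K F i j k x : (ends F).1 = vtx K i ->
  (ends F).2 = vtx K j ->
  [/\ i != k, j != k, i != j & forall l, [|| l == i, l == j | l == k]] ->
  bary K k x = 0 -> x = edge_point F (bary K j x).
Proof.
move=> i1 j1 [ik jk ij _] x0; rewrite /edge_point i1 j1.
have s1 := bary_sum nondeg K x.
rewrite {1}[x](bary_pos nondeg K).
move: s1; rewrite !(bigD1 (P := predT) k) //= x0 scale0r !add0r.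
rewrite !(bigD1 (P := fun l => l != k) i) //=.
rewrite !(bigD1 (P := fun l => (l != k) && (l != i)) j) /=
  ?jk ?[j == i]eq_sym ?ij //.
rewrite !big1 ?addr0; first last.
- move: i j k ik jk ij {x0 i1 j1}.
  by do 3! apply: ord3P => //; move=> ? ? ?; apply: ord3P.
- move: i j k ik jk ij {x0 i1 j1}.
  by do 3! apply: ord3P => //; move=> ? ? ?; apply: ord3P.
move=> /(canRL (addrK _)) ->.
by rewrite scalerBl scale1r scalerBr addrAC addrA.
Qed.

(** Families whose elementwise functions are, by conversion, the generators of
    the explicit space. *)
Definition bubble_family F K x : R :=
  if F \in edges K then (legendre (p - 1)).[1 - 2 * bary_edge K F x] else 0.

Definition modal_family (j : nat) F K x : R :=
  if F \in edges K then
    let la := bary_node K (ends F).1 x in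
    let lb := bary_node K (ends F).2 x in
    8 * Num.sqrt (4 * j + 2)%:R / (j * (j + 1))%:R *
      la * lb * ((legendre j)^`()).[lb - la]
  else 0.

Definition elemental_family (r1 r2 : nat) K0 K x : R :=
  if K == K0 then
    let l1 := bary K0 0 x in
    let l2 := bary K0 1 x in
    let l3 := bary K0 2 x in
    l1 * l2 * l3 * (legendre r1).[l2 - l1] * (legendre r2).[2 * l3 - 1]
  else 0.

Lemma bary_lin K i (a b : R) : affine_in fst snd (fun x => a + b * bary K i x).
Proof.
have [c [d [e E]]] := bary_affine K i; exists (a + b * c), (b * d), (b * e) => z.
by rewrite E; ring.
Qed.

Lemma bary_diff K i j : affine_in fst snd (fun x => bary K j x - bary K i x).
Proof.
have [c [d [e E]]] := bary_affine K i; have [c' [d' [e' E']]] := bary_affine K j.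
exists (c' - c), (d' - d), (e' - e) => z.
by rewrite E E'; ring.
Qed.

Lemma plane_poly0 n : plane_poly fst snd n (fun _ : R * R => 0 : R).
Proof. by have [] := @plane_poly_closed R fst snd n. Qed.

Lemma odd_p1 : odd (p - 1).
Proof. by rewrite oddB // (negPf p_even). Qed.

(** Enough to compare traces up to the free Legendre polynomial with a
    reference that does not depend on the element. *)
Lemma nonconforming_family_trace Q (tr : {set node T} -> R -> R) :
  (forall K, plane_poly fst snd p.+1 (Q K)) ->
  (forall K F, F \in edges K -> exists a, forall t,
     Q K (edge_point F t) = tr F t + a * (legendre (p - 1)).[2 * t - 1]) ->
  nonconforming_family Q.
Proof.
move=> PQ H; split=> // F K1 K2 _ F1 F2.
have [a aE] := H _ _ F1; have [b bE] := H _ _ F2.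
by exists (a - b) => t; rewrite aE bE; ring.
Qed.

(** On its own edge the bubble is 1; on the two other edges of the element it
    is the free Legendre polynomial, up to sign. *)
Lemma bubble_values K F i j k t : F = edge K k -> (ends F).1 = vtx K i ->
  (ends F).2 = vtx K j -> i != k -> j != k -> i != j ->
  [/\ bubble_family (edge K i) K (edge_point F t) = (legendre (p - 1)).[2 * t - 1],
      bubble_family (edge K j) K (edge_point F t) = - (legendre (p - 1)).[2 * t - 1] &
      bubble_family (edge K k) K (edge_point F t) = 1].
Proof.
move=> Fk i1 j1 ik jk ij.
have [bi bj bk] := bary_edge_point t Fk i1 j1 ik jk ij.
rewrite /bubble_family !edge_in_edges !bary_edgeE // bi bj bk; split.
- by congr (_.[_]); ring.
- have -> : 1 - 2 * t = - (2 * t - 1) by ring.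
  by rewrite legendre_opp -signr_odd odd_p1 expr1 mulN1r.
- by rewrite mulr0 subr0 legendre1.
Qed.

Lemma bubble_trace F K F' : F' \in edges K -> exists a, forall t,
  bubble_family F K (edge_point F' t) =
    (F == F')%:R + a * (legendre (p - 1)).[2 * t - 1].
Proof.
move=> F'K; have [i [j [k [F'k i1 j1 [ik jk ij all3]]]]] := edge_endsP F'K.
have B t := bubble_values t F'k i1 j1 ik jk ij.
have [/edgesP[l ->]|FK] := boolP (F \in edges K); last first.
  exists 0 => t; rewrite /bubble_family (negPf FK) mul0r addr0.
  by case: eqP => // E; rewrite E F'K in FK.
have -> : (edge K l == F') = (l == k).
  by rewrite F'k (inj_eq (@edge_inj _ _ nondeg K)).
case/or3P: (all3 l) => /eqP ->.
- by exists 1 => t; have [-> _ _] := B t; rewrite (negPf ik) add0r mul1r.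
- by exists (-1) => t; have [_ -> _] := B t; rewrite (negPf jk) add0r mulN1r.
- by exists 0 => t; have [_ _ ->] := B t; rewrite eqxx mul0r addr0.
Qed.

Lemma bubble_nonconforming F : nonconforming_family (bubble_family F).
Proof.
apply: (@nonconforming_family_trace _ (fun F' _ => (F == F')%:R)); last first.
  by move=> K F' F'K; exact: bubble_trace.
move=> K; rewrite /bubble_family.
case: (boolP (F \in edges K)) => [/edgesP[l ->]|_]; last exact: plane_poly0.
rewrite (_ : (fun x => _) =
    fun x => (legendre (p - 1)).[1 + (- 2) * bary K l x] * 1); last first.
  by apply/funext => x; rewrite bary_edgeE // mulr1; congr (_.[_]); ring.
apply: (@plane_poly_leq _ _ _ ((p - 1) + 1)); first by lia.
apply: plane_poly_mul_comp; [exact: bary_lin|by rewrite size_legendre|].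
exact: plane_poly1.
Qed.

Lemma modal_trace (j : nat) F K F' t : F' \in edges K ->
  modal_family j F K (edge_point F' t) = (F == F')%:R *
    (modal_coef j * (1 - t) * t * ((legendre j)^`()).[2 * t - 1]).
Proof.
move=> F'K; rewrite /modal_family; case: (boolP (F \in edges K)) => [FK|FK]; last first.
  case: eqP => [E|_]; last by rewrite mul0r.
  by rewrite E F'K in FK.
have [i [l [k [Fk i1 l1 [ik lk il all3]]]]] := edge_endsP FK.
rewrite i1 l1 /= !bary_nodeE //.
have [E|FF'] := eqVneq F F'.
  rewrite -E; have [-> -> _] := bary_edge_point t Fk i1 l1 ik lk il.
  by rewrite mul1r /modal_coef; congr (_ * _.[_]); ring.
have [m F'm] := edgesP F'K.
have [i' [j' [k' [F'k' i1' j1' [ik' jk' ij' _]]]]] := edge_endsP F'K.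
have [_ _ bk'] := bary_edge_point t F'k' i1' j1' ik' jk' ij'.
rewrite mul0r; case/or3P: (all3 k') => /eqP k'E.
- by rewrite -k'E bk' mulr0 !mul0r.
- by rewrite -k'E bk' mulr0 mul0r.
- by rewrite Fk F'k' k'E eqxx in FF'.
Qed.

Lemma modal_nonconforming (j : nat) F : (1 <= j <= p - 1)%N ->
  nonconforming_family (modal_family j F).
Proof.
move=> jp.
apply: (@nonconforming_family_trace _ (fun F' t => (F == F')%:R *
    (modal_coef j * (1 - t) * t * ((legendre j)^`()).[2 * t - 1]))); last first.
  by move=> K F' F'K; exists 0 => t; rewrite modal_trace // mul0r addr0.
move=> K; rewrite /modal_family.
case: (boolP (F \in edges K)) => [FK|_]; last exact: plane_poly0.
have [i [l [k [Fk i1 l1 _]]]] := edge_endsP FK.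
rewrite (_ : (fun x => _) = fun x => modal_coef j * (bary K i x * (bary K l x *
    (((legendre j)^`()).[bary K l x - bary K i x] * 1)))); last first.
  by apply/funext => x; rewrite i1 l1 /= !bary_nodeE // /modal_coef; ring.
have [_ _ QZ] := @plane_poly_closed R fst snd p.+1; apply: QZ.
apply: (@plane_poly_leq _ _ _ (((j - 1) + 1).+2)); first by lia.
apply: plane_poly_mul_affine; first exact: bary_affine.
apply: plane_poly_mul_affine; first exact: bary_affine.
apply: plane_poly_mul_comp; [exact: bary_diff| |exact: plane_poly1].
by rewrite size_deriv_char0 size_legendre; lia.
Qed.

Lemma elemental_nonconforming r1 r2 K0 : (r1 + r2 + 3 <= p)%N ->
  nonconforming_family (elemental_family r1 r2 K0).
Proof.
move=> rp; apply: (@nonconforming_family_trace _ (fun _ _ => 0)); last first.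
  move=> K F FK; exists 0 => t; rewrite mul0r addr0 /elemental_family.
  case: eqP => // KK0; rewrite -KK0.
  have [i [l [k [Fk i1 l1 [ik lk il _]]]]] := edge_endsP FK.
  have [_ _] := bary_edge_point t Fk i1 l1 ik lk il.
  by move: k {Fk ik lk}; apply: ord3P => -> /=; rewrite ?mulr0 ?mul0r.
move=> K; rewrite /elemental_family; case: (K == K0); last exact: plane_poly0.
rewrite (_ : (fun x => _) = fun x => bary K0 0 x * (bary K0 1 x * (bary K0 2 x *
    ((legendre r1).[bary K0 1 x - bary K0 0 x] *
     ((legendre r2).[- 1 + 2 * bary K0 2 x] * 1))))); last first.
  apply/funext => x /=; rewrite mulr1.
  by rewrite (_ : - 1 + 2 * bary K0 2 x = 2 * bary K0 2 x - 1) 1?addrC //; ring.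
apply: (@plane_poly_leq _ _ _ (r1 + (r2 + 1)).+3); first by lia.
apply: plane_poly_mul_affine; first exact: bary_affine.
apply: plane_poly_mul_affine; first exact: bary_affine.
apply: plane_poly_mul_affine; first exact: bary_affine.
apply: plane_poly_mul_comp; [exact: bary_diff|by rewrite size_legendre|].
apply: plane_poly_mul_comp; [exact: bary_lin|by rewrite size_legendre|].
exact: plane_poly1.
Qed.

Lemma elementwiseD G Q x :
  elementwise (fun K y => G K y + Q K y) x = elementwise G x + elementwise Q x.
Proof. by rewrite -big_split; apply: eq_bigr => K _; rewrite mulrDr. Qed.

Lemma elementwiseZ c G x : elementwise (fun K y => c * G K y) x = c * elementwise G x.
Proof. by rewrite /elementwise mulr_sumr; apply: eq_bigr => K _; rewrite mulrCA. Qed.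

Lemma elementwise0 x : elementwise (fun (K : elt T) _ => 0 : R) x = 0.
Proof. by rewrite /elementwise big1 // => K _; rewrite mulr0. Qed.

Lemma nonconforming_family_closed : linear_class
  (fun w => exists2 Q, nonconforming_family Q & w = elementwise Q).
Proof.
split.
- exists (fun _ _ => 0); last by apply/funext => x; rewrite elementwise0.
  split; first by move=> K; exact: plane_poly0.
  by move=> F K1 K2 _ _ _; exists 0 => t; rewrite subrr mul0r.
- move=> _ _ [G [PG jG] ->] [Q [PQ jQ] ->].
  exists (fun K x => G K x + Q K x); last by apply/funext => x; rewrite elementwiseD.
  split=> [K|F K1 K2 K12 F1 F2].
    by have [_ QD _] := @plane_poly_closed R fst snd p.+1; exact: QD.
  have [a aE] := jG F K1 K2 K12 F1 F2; have [b bE] := jQ F K1 K2 K12 F1 F2.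
  by exists (a + b) => t; rewrite mulrDl -aE -bE; ring.
- move=> c _ [G [PG jG] ->].
  exists (fun K x => c * G K x); last by apply/funext => x; rewrite elementwiseZ.
  split=> [K|F K1 K2 K12 F1 F2].
    by have [_ _ QZ] := @plane_poly_closed R fst snd p.+1; exact: QZ.
  have [a aE] := jG F K1 K2 K12 F1 F2.
  by exists (c * a) => t; rewrite -mulrA -aE; ring.
Qed.

Lemma span_nonconforming w : linear_span (V_ex_generators ends p) w ->
  exists2 Q, nonconforming_family Q & w = elementwise Q.
Proof.
apply: (linear_span_sub (Q := fun w => exists2 Q, nonconforming_family Q &
  w = elementwise Q)); first exact: nonconforming_family_closed.
move=> g [[[F _ ->]|[F _ [j jp ->]]]|[K [r1 [r2 [rp ->]]]]].
- by exists (bubble_family F) => //; exact: bubble_nonconforming.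
- by exists (modal_family j F) => //; exact: modal_nonconforming.
- by exists (elemental_family r1 r2 K); [exact: elemental_nonconforming|].
Qed.


Lemma edge_point0 F : edge_point F 0 = pos (ends F).1.
Proof. by rewrite /edge_point scale0r addr0. Qed.

Lemma edge_point1 F : edge_point F 1 = pos (ends F).2.
Proof. by rewrite /edge_point scale1r addrC subrK. Qed.

(** The mean of the two end values and the modal coefficients are common to the
    elements sharing the edge: the free Legendre polynomial is odd, so a
    multiple of it changes neither. *)
Lemma edge_data Q F : nonconforming_family Q -> F \in mesh_edges ->
  exists cd : R * (nat -> R), forall K, F \in edges K ->
    cd.1 = (Q K (pos (ends F).1) + Q K (pos (ends F).2)) / 2 /\
    forall t, Q K (edge_point F t) = cd.1 +
      (Q K (pos (ends F).2) - Q K (pos (ends F).1)) / 2 *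
        (legendre (p - 1)).[2 * t - 1] +
      \sum_(j < p | (0 < j)%N) cd.2 j *
        (modal_coef j * (1 - t) * t * ((legendre j)^`()).[2 * t - 1]).
Proof.
move=> [PQ jQ] /bigcupP[K0 _ FK0].
have [r sr rE] := plane_poly_segment (pos (ends F).1) (pos (ends F).2) (PQ K0).
have [d dE] := edge_expansion p_gt0 p_even sr.
exists ((r.[0] + r.[1]) / 2, d) => K FK /=.
have [a aE] : exists a, forall t, Q K (edge_point F t) =
    r.[t] + a * (legendre (p - 1)).[2 * t - 1].
  have [->|/eqP KK0] := eqVneq K K0; first by exists 0 => t; rewrite mul0r addr0 -rE.
  have [a aE] := jQ F K K0 KK0 FK FK0.
  by exists a => t; rewrite -aE -rE; ring.
have Q0 : Q K (pos (ends F).1) = r.[0] - a.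
  rewrite -edge_point0 aE (_ : 2 * 0 - 1 = -1); last by ring.
  by rewrite legendreN1 -signr_odd odd_p1 expr1 mulrN1.
have Q1 : Q K (pos (ends F).2) = r.[1] + a.
  rewrite -edge_point1 aE (_ : 2 * 1 - 1 = 1); last by ring.
  by rewrite legendre1 mulr1.
rewrite Q0 Q1; split; first by congr (_ / _); ring.
by move=> t; rewrite aE dE; set S := \sum_(_ < _ | _) _; field.
Qed.

Lemma sum_edges K (u : {set node T} -> R) : (forall F, F \notin edges K -> u F = 0) ->
  \sum_(F in mesh_edges) u F = \sum_l u (edge K l).
Proof.
move=> u0; rewrite (bigID (mem (edges K))) /= [X in _ + X]big1 ?addr0; last first.
  by move=> F /andP[_ /u0].
rewrite (eq_bigl (mem (edges K))); last first.
  move=> F /=; case FK: (F \in edges K); last by rewrite andbF.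
  by rewrite (edges_mesh_edges FK).
rewrite big_imset /=; last by move=> ? ? _ _; exact: edge_inj.
by apply: eq_bigl => l; rewrite inE.
Qed.

Lemma sum_three i j k (u : 'I_3 -> R) : i != k -> j != k -> i != j ->
  \sum_l u l = u i + u j + u k.
Proof.
rewrite sum_ord3; move: i j k; do 3! apply: ord3P => //; move=> _ _ _; ring.
Qed.

(** Divisibility by a barycentric coordinate only requires vanishing on the
    open edge. *)
Lemma bary_factor K i n f : plane_poly fst snd n f ->
  (forall x, bary K i x = 0 -> 0 < bary K (i + 1) x -> 0 < bary K (i + 2) x ->
    f x = 0) ->
  exists2 g, plane_poly fst snd n.-1 g & forall x, f x = bary K i x * g x.
Proof.
move=> Pf f0.
have coords x : x = pos (vtx K (i + 2)) +
    bary K (i + 1) x *: (pos (vtx K (i + 1)) - pos (vtx K (i + 2))) +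
    bary K i x *: (pos (vtx K i) - pos (vtx K (i + 2))).
  have s1 := bary_sum nondeg K x; rewrite {1}[x](bary_pos nondeg K).
  have E (V : nmodType) (u : 'I_3 -> V) : \sum_l u l = u i + u (i + 1) + u (i + 2).
    rewrite sum_ord3; move: (i); apply: ord3P; rewrite !ord3_add //.
      by rewrite -addrA addrC.
    by rewrite addrC addrA.
  move: s1; rewrite !E => s1.
  have -> : bary K (i + 2) x = 1 - bary K i x - bary K (i + 1) x by rewrite -s1; ring.
  by rewrite !scale_pairE; congr pair => /=; ring.
have af1 : affine_in (bary K (i + 1)) (bary K i) fst.
  exists (pos (vtx K (i + 2))).1, (pos (vtx K (i + 1)) - pos (vtx K (i + 2))).1,
    (pos (vtx K i) - pos (vtx K (i + 2))).1 => z.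
  by rewrite {1}(coords z) !scale_pairE /=; ring.
have af2 : affine_in (bary K (i + 1)) (bary K i) snd.
  exists (pos (vtx K (i + 2))).2, (pos (vtx K (i + 1)) - pos (vtx K (i + 2))).2,
    (pos (vtx K i) - pos (vtx K (i + 2))).2 => z.
  by rewrite {1}(coords z) !scale_pairE /=; ring.
have [|g Pg gE] := plane_poly_factor (plane_poly_change af1 af2 Pf).
  move=> t /andP[t0 t1].
  pose w l : R := if l == i then 0 else if l == i + 1 then t else 1 - t.
  have w1 : \sum_l w l = 1.
    by rewrite sum_ord3 /w; move: (i); apply: ord3P; rewrite !ord3_add /=; ring.
  have i1 : (i + 1 == i) = false by move: (i); exact: ord3P.
  have i2 : ((i + 2 == i) = false) * ((i + 2 == i + 1) = false).
    by split; move: (i); exact: ord3P.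
  exists (\sum_l w l *: pos (vtx K l)).
  have wE l := bary_comb nondeg K l w1.
  have wi : w i = 0 by rewrite /w eqxx.
  have wi1 : w (i + 1) = t by rewrite /w i1 eqxx.
  split; [by rewrite wE wi1|by rewrite wE wi|].
  apply: f0; rewrite wE // /w ?eqxx // ?i1 ?i2 ?eqxx //; lra.
exists g => //; apply: plane_poly_change Pg; exact: bary_affine.
Qed.

(** The quotient by one coordinate still vanishes on the other edges, where that
    coordinate is positive. *)
Lemma bary_factor3 K n f : plane_poly fst snd n f ->
  (forall k x, bary K k x = 0 -> f x = 0) ->
  exists2 g, plane_poly fst snd (n - 3) g &
    forall x, f x = bary K 0 x * bary K 1 x * bary K 2 x * g x.
Proof.
move=> Pf f0.
have [|g0 Pg0 g0E] := bary_factor (K := K) (i := 0) Pf.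
  by move=> x x0 _ _; exact: f0 x0.
have [|g1 Pg1 g1E] := bary_factor (K := K) (i := 1) Pg0.
  move=> x x0; rewrite !ord3_add => _ b0; apply: (mulfI (lt0r_neq0 b0)).
  by rewrite mulr0 -g0E (f0 1).
have [|g2 Pg2 g2E] := bary_factor (K := K) (i := 2) Pg1.
  move=> x x0; rewrite !ord3_add => b0 b1.
  apply: (mulfI (lt0r_neq0 b1)); rewrite mulr0 -g1E.
  by apply: (mulfI (lt0r_neq0 b0)); rewrite mulr0 -g0E (f0 2).
exists g2; first by rewrite !subnS subn0.
by move=> x; rewrite g0E g1E g2E; ring.
Qed.

Lemma span_elementwise_closed :
  let S G := linear_span (V_ex_generators ends p) (elementwise G) in
  [/\ S (fun _ _ => 0), forall G Q, S G -> S Q -> S (fun K x => G K x + Q K x) &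
      forall c G, S G -> S (fun K x => c * G K x)].
Proof.
have [S0 SD SZ] := linear_span_closed (V_ex_generators ends p).
split.
- rewrite (_ : elementwise _ = fun=> 0) //.
  by apply/funext => x; rewrite elementwise0.
- move=> G Q SG SQ.
  rewrite (_ : elementwise _ = fun x => elementwise G x + elementwise Q x).
    exact: SD.
  by apply/funext => x; rewrite elementwiseD.
- move=> c G SG; rewrite (_ : elementwise _ = fun x => c * elementwise G x).
    exact: SZ.
  by apply/funext => x; rewrite elementwiseZ.
Qed.

Lemma span_elementwise_sum (I : Type) (r : seq I) (P : pred I)
    (G : I -> elt T -> R * R -> R) :
  (forall a : I, P a ->
    linear_span (V_ex_generators ends p) (elementwise (G a))) ->
  linear_span (V_ex_generators ends p)
    (elementwise (fun K x => \sum_(a <- r | P a) G a K x)).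
Proof.
have [S0 SD _] := span_elementwise_closed => SG.
elim: r => [|i r IH].
  rewrite (_ : (fun K x => _) = (fun _ _ => 0)) //.
  by apply/funext => K; apply/funext => x; rewrite big_nil.
case Pi: (P i).
  rewrite (_ : (fun K x => _) = (fun K x => G i K x + \sum_(a <- r | P a) G a K x)).
    by apply: SD => //; exact: SG.
  by apply/funext => K; apply/funext => x; rewrite big_cons Pi.
rewrite (_ : (fun K x => _) = (fun K x => \sum_(a <- r | P a) G a K x)) //.
by apply/funext => K; apply/funext => x; rewrite big_cons Pi.
Qed.

(** Each element contributes separately, since its part of the family can be cut
    off without leaving the polynomials that vanish on edges. *)
Lemma span_vanishing_on_edges G :
  (forall K, plane_poly fst snd p.+1 (G K)) ->
  (forall K k x, bary K k x = 0 -> G K x = 0) ->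
  linear_span (V_ex_generators ends p) (elementwise G).
Proof.
move=> PG G0; have [S0 SD SZ] := span_elementwise_closed.
rewrite (_ : G = fun K x => \sum_K0 (if K == K0 then G K0 x else 0)); last first.
  apply/funext => K; apply/funext => x; rewrite (bigD1 K) //= eqxx big1 ?addr0 // => K0.
  by rewrite eq_sym => /negPf ->.
apply: span_elementwise_sum => K0 _.
have [g Pg gE] := bary_factor3 (PG K0) (G0 K0).
pose s x := bary K0 1 x - bary K0 0 x; pose t x := 2 * bary K0 2 x - 1.
have coords x : x = ((1 - s x) / 2 - (t x + 1) / 4) *: pos (vtx K0 0) +
    ((1 + s x) / 2 - (t x + 1) / 4) *: pos (vtx K0 1) +
    ((t x + 1) / 2) *: pos (vtx K0 2).
  have s1 := bary_sum nondeg K0 x; rewrite sum_ord3 in s1.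
  rewrite {1}[x](bary_pos nondeg K0) sum_ord3.
  have b0 : bary K0 0 x = 1 - bary K0 1 x - bary K0 2 x by rewrite -s1; ring.
  by congr (_ *: _ + _ *: _ + _ *: _); rewrite /s /t ?b0; field.
have af1 : affine_in s t fst.
  set a := (pos (vtx K0 0)).1; set b := (pos (vtx K0 1)).1; set c := (pos (vtx K0 2)).1.
  exists (a / 4 + b / 4 + c / 2), (b / 2 - a / 2), (c / 2 - a / 4 - b / 4) => z.
  by rewrite {1}(coords z) !scale_pairE /= -/a -/b -/c; field.
have af2 : affine_in s t snd.
  set a := (pos (vtx K0 0)).2; set b := (pos (vtx K0 1)).2; set c := (pos (vtx K0 2)).2.
  exists (a / 4 + b / 4 + c / 2), (b / 2 - a / 2), (c / 2 - a / 4 - b / 4) => z.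
  by rewrite {1}(coords z) !scale_pairE /= -/a -/b -/c; field.
pose Q f := linear_span (V_ex_generators ends p) (elementwise (fun K x =>
  if K == K0 then bary K0 0 x * bary K0 1 x * bary K0 2 x * f x else 0)).
have : Q g.
  apply: (plane_poly_legendre_ind (Q := Q) _ _ (plane_poly_change af1 af2 Pg)).
    split.
    - rewrite /Q (_ : (fun K x => _) = (fun _ _ => 0)) //.
      by apply/funext => K; apply/funext => x; rewrite mulr0 if_same.
    - move=> u v Qu Qv; have := SD _ _ Qu Qv; congr (linear_span _ (elementwise _)).
      apply/funext => K; apply/funext => x; case: eqP => _; last by rewrite addr0.
      by rewrite mulrDr.
    - move=> c u Qu; have := SZ c _ Qu; congr (linear_span _ (elementwise _)).
      apply/funext => K; apply/funext => x; case: eqP => _; last by rewrite mulr0.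
      by rewrite mulrCA.
  move=> i j ij; apply: linear_span_gen; right; exists K0, i, j; split; first by lia.
  congr (elementwise _); apply/funext => K; apply/funext => x.
  by case: eqP => // _; rewrite mulrA.
congr (linear_span _ (elementwise _)); apply/funext => K; apply/funext => x.
by case: eqP => // _; rewrite gE.
Qed.

(** Subtracting, edge by edge, the bubble scaled by the mean of the end values
    and the modal part of the trace leaves on an edge only a multiple of the
    free Legendre polynomial. The bubbles of the two other edges cancel it,
    since their coefficients differ by half the difference of the end values. *)
Lemma nonconforming_span Q : nonconforming_family Q ->
  linear_span (V_ex_generators ends p) (elementwise Q).
Proof.
move=> ncQ; have [PQ _] := ncQ.
have /choice[cd cdP] : forall F : {set node T}, exists cd : R * (nat -> R),
    F \in mesh_edges -> forall K, F \in edges K ->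
    cd.1 = (Q K (pos (ends F).1) + Q K (pos (ends F).2)) / 2 /\
    forall t, Q K (edge_point F t) = cd.1 +
      (Q K (pos (ends F).2) - Q K (pos (ends F).1)) / 2 *
        (legendre (p - 1)).[2 * t - 1] +
      \sum_(j < p | (0 < j)%N) cd.2 j *
        (modal_coef j * (1 - t) * t * ((legendre j)^`()).[2 * t - 1]).
  move=> F; have [FT|_] := boolP (F \in mesh_edges); last by exists (0, fun=> 0).
  by have [cd cdP] := edge_data ncQ FT; exists cd.
pose edge_part F K x := (cd F).1 * bubble_family F K x +
  \sum_(j < p | (0 < j)%N) (cd F).2 j * modal_family j F K x.
pose G K x := Q K x - \sum_(F in mesh_edges) edge_part F K x.
have [S0 SD SZ] := span_elementwise_closed.
have SE F : F \in mesh_edges ->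
    linear_span (V_ex_generators ends p) (elementwise (edge_part F)).
  move=> FT; apply: SD.
    by apply: SZ; apply: linear_span_gen; left; left; exists F.
  apply: span_elementwise_sum => j j0; apply: SZ; apply: linear_span_gen.
  by left; right; exists F => //; exists j => //; have := ltn_ord j; lia.
rewrite (_ : Q = fun K x => G K x + \sum_(F in mesh_edges) edge_part F K x); last first.
  by apply/funext => K; apply/funext => x; rewrite subrK.
apply: SD; last exact: span_elementwise_sum.
have [P0 PD PZ] := @plane_poly_closed R fst snd p.+1.
have LP := @plane_poly_closed R fst snd p.+1.
apply: span_vanishing_on_edges => [K|K k x xk].
  have PE : plane_poly fst snd p.+1 (fun x => \sum_(F in mesh_edges) edge_part F K x).
    apply: linear_class_sum => // F _; apply: PD.
      by apply: PZ; have [+ _] := bubble_nonconforming F; apply.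
    apply: linear_class_sum => // j j0; apply: PZ.
    have jp : (1 <= j <= p - 1)%N by have := ltn_ord j; lia.
    by have [+ _] := modal_nonconforming F jp; apply.
  have := PD _ _ (PQ K) (PZ (-1) _ PE); congr (plane_poly _ _ _ _).
  by apply/funext => x; rewrite mulN1r.
have FK := edge_in_edges K k; set F := edge K k in FK.
have FT := edges_mesh_edges FK.
have [i [j [k' [Fk i1 j1 all3]]]] := edge_endsP FK.
have kk : k = k' by apply: (@edge_inj _ _ nondeg K).
rewrite -kk in Fk all3; have [ik jk ij _] := all3.
rewrite (edge_point_bary i1 j1 all3 xk); set t := bary K j x.
have [bi bj bk] := bubble_values t Fk i1 j1 ik jk ij.
have mean l : (cd (edge K l)).1 = (\sum_(m | m != l) Q K (pos (vtx K m))) / 2.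
  have lK := edge_in_edges K l.
  have [-> _] := cdP _ (edges_mesh_edges lK) _ lK.
  have [a [b [l' [El a1 b1 [al bl ab _]]]]] := edge_endsP lK.
  have ll : l = l' by apply: (@edge_inj _ _ nondeg K).
  rewrite a1 b1; congr (_ / _); rewrite big_mkcond (@sum_three a b l) -?ll //.
  - by rewrite ll al bl eqxx addr0.
  - by rewrite ll.
  - by rewrite ll.
have edge_partE l : edge_part (edge K l) K (edge_point F t) =
    (cd (edge K l)).1 * bubble_family (edge K l) K (edge_point F t) +
    if l == k then \sum_(j < p | (0 < j)%N) (cd F).2 j *
      (modal_coef j * (1 - t) * t * ((legendre j)^`()).[2 * t - 1]) else 0.
  congr (_ + _); case: eqP => [->|/eqP lk].
    by apply: eq_bigr => m _; rewrite modal_trace // eqxx mul1r.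
  rewrite big1 // => m _; rewrite modal_trace // (inj_eq (@edge_inj _ _ nondeg K)).
  by rewrite (negPf lk) mul0r mulr0.
rewrite /G (@sum_edges K); last first.
  move=> F' F'K; rewrite /edge_part /bubble_family (negPf F'K) mulr0 add0r.
  by rewrite big1 // => m _; rewrite /modal_family (negPf F'K) mulr0.
rewrite (@sum_three i j k) // !edge_partE bi bj bk (negPf ik) (negPf jk) eqxx.
have [_ ->] := cdP F FT K FK.
rewrite i1 j1 -/F !mean.
rewrite ![\sum_(_ | _ != _) _]big_mkcond !(@sum_three i j k) //= !eqxx ik jk ij.
rewrite [j == i]eq_sym (negPf ij) /= ![k == _]eq_sym (negPf ik) (negPf jk) /=.
set S := \sum_(_ < _ | _) _.
by field.
Qed.

End Families.

(** * Moments of the jumps *)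

Section Traces.
Context {R : realType} {T : mesh R} {Omega : set (R * R)}.
Hypothesis Tconf : @conforming_mesh R T Omega.
Variables (ends : {set node T} -> node T * node T) (nF : {set node T} -> R * R).
Hypotheses (endsP : edge_orientation ends) (nFP : unit_edge_normals nF).
Local Notation mu := (@area_measure R).
Implicit Types (K : elt T) (F : {set node T}) (Q : elt T -> R * R -> R).
Implicit Types (v w : R * R -> R) (x : R * R).

Let nondeg := mesh_nondegenerate Tconf.

Lemma elementwise_interior Q K x : (triangle K)° x -> elementwise Q x = Q K x.
Proof.
move=> xK; rewrite /elementwise (bigD1 K) //= big1 ?addr0.
  by rewrite indicE mem_set // mul1r.
move=> K' K'K; rewrite indicE memNset ?mul0r // => /interior_subset xK'.
by apply: (interior_disjoint Tconf _ xK xK') => E; rewrite E eqxx in K'K.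
Qed.

Lemma edge_point_triangle K F (t : R) : F \in edges K -> 0 <= t <= 1 ->
  triangle K (edge_point ends F t).
Proof.
move=> FK /andP[t0 t1].
have [i [j [k [Fk i1 j1 [ik jk ij all3]]]]] := edge_endsP nondeg endsP FK.
have [bi bj bk] := bary_edge_point nondeg t Fk i1 j1 ik jk ij.
apply/(triangleP nondeg) => l; case/or3P: (all3 l) => /eqP ->.
- by rewrite bi subr_ge0.
- by rewrite bj.
- by rewrite bk.
Qed.

Lemma edge_ends_neq K F : F \in edges K -> pos (ends F).2 - pos (ends F).1 != 0.
Proof.
move=> FK; have [i [j [k [_ i1 j1 [_ _ ij _]]]]] := edge_endsP nondeg endsP FK.
rewrite subr_eq0; apply: contraNneq ij => /(mesh_pos_inj Tconf).
by rewrite i1 j1 => /(vtx_inj nondeg) ->.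
Qed.

Lemma edge_legendre_point K F (j : nat) (t : R) : F \in edges K ->
  edge_legendre ends j F (edge_point ends F t) = (legendre j).[2 * t - 1].
Proof.
move=> /edge_ends_neq d0; rewrite /edge_legendre /edge_point.
set a := pos (ends F).1; set d := pos (ends F).2 - a in d0 *.
have -> : dot (a + t *: d - a) d = t * dot d d.
  by rewrite scale_pairE /dot /=; ring.
by rewrite mulfK // gt_eqF // dot_gt0.
Qed.

(** The moments of a jump are moments of a univariate polynomial in the
    parameter of the edge; the two normal factors are opposite and nonzero. *)
Lemma jump_moment p Q v F K1 K2 (r : {poly R}) (j : nat) :
  (forall K, poly_fun p (Q K)) -> (forall K, ae_eq mu (triangle K) v (Q K)) ->
  K1 <> K2 -> F \in edges K1 -> F \in edges K2 -> F \in internal_edges ->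
  (forall t, Q K1 (edge_point ends F t) - Q K2 (edge_point ends F t) = r.[2 * t - 1]) ->
  exists2 c, c != 0 &
    edge_inner ends F (jump nF F K1 K2 v) (edge_legendre ends j F) =
      c * itg (r * legendre j).
Proof.
move=> PQ vQ K12 F1 F2 intF rE.
have [opp n0] := outward_normals_cancel Tconf nFP intF K12 F1 F2.
set s := dot (outward_normal K1 F) (nF F) in opp n0.
exists (enorm (pos (ends F).2 - pos (ends F).1) * s).
  by rewrite mulf_neq0 // gt_eqF // sqrtr_gt0 dot_gt0 // (edge_ends_neq F1).
rewrite -mulrA -itgZ /edge_inner; congr (_ * _); apply: eq_Rintegral => t.
rewrite inE /= in_itv /= => t01.
rewrite -/(edge_point ends F t) (edge_legendre_point _ _ F1) hornerZ hornerM mulrA.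
congr (_ * _); rewrite -rE /jump opp -/s.
have rep K : F \in edges K ->
    continuous_rep (triangle K) v (edge_point ends F t) = Q K (edge_point ends F t).
  move=> FK; apply: (continuous_rep_triangle nondeg _ (vQ K)).
    by apply: (@plane_poly_continuous R p.+1); exact/poly_funE.
  exact: edge_point_triangle.
by rewrite !rep //; ring.
Qed.

Lemma internal_edgeP F K1 K2 : K1 <> K2 -> F \in edges K1 -> F \in edges K2 ->
  F \in internal_edges.
Proof.
move=> K12 F1 F2; rewrite inE (edges_mesh_edges F1) /=.
apply/card_gt1P; exists K1, K2; split; rewrite ?inE //.
exact/eqP.
Qed.

(** The parameter of the edge is rescaled to [[-1, 1]], where the Legendre
    polynomials live. *)
Lemma jump_poly p Q F K1 K2 : (forall K, poly_fun p (Q K)) ->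
  exists2 r : {poly R}, (size r <= p.+1)%N & forall t,
    Q K1 (edge_point ends F t) - Q K2 (edge_point ends F t) = r.[2 * t - 1].
Proof.
move=> PQ; set a := pos (ends F).1; set b := pos (ends F).2.
have /poly_funE P1 := PQ K1; have /poly_funE P2 := PQ K2.
have [r1 s1 E1] := plane_poly_segment a b P1.
have [r2 s2 E2] := plane_poly_segment a b P2.
have sL : size (2^-1 *: ('X + 1) : {poly R}) = 2.
  by rewrite size_scale ?invr_eq0 ?pnatr_eq0 // -[1]/(1%:P) size_XaddC.
exists ((r1 - r2) \Po (2^-1 *: ('X + 1))) => [|t].
  rewrite size_comp_poly2 // (leq_trans (size_polyD _ _)) // size_polyN geq_max.
  by rewrite s1 s2.
rewrite /edge_point -/a -/b E1 E2 horner_comp !hornerE.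
by have -> : 2^-1 * (2 * t - 1 + 1) = t by field.
Qed.

(** The jump conditions of the implicit space leave only the Legendre
    polynomial of degree [p - 1]. *)
Lemma edge_moments_nonconforming p Q v : (1 < p)%N ->
  (forall K, poly_fun p (Q K)) -> (forall K, ae_eq mu (triangle K) v (Q K)) ->
  (forall F, F \in internal_edges ->
    forall K1 K2, K1 <> K2 -> F \in edges K1 -> F \in edges K2 ->
    forall j : nat, (j <= p - 2)%N || (j == p) ->
      edge_inner ends F (jump nF F K1 K2 v) (edge_legendre ends j F) = 0) <->
  nonconforming_family ends p Q.
Proof.
move=> p1 PQ vQ; split=> [H|[_ jQ]].
  split=> [K|F K1 K2 K12 F1 F2]; first exact/poly_funE.
  have intF := internal_edgeP K12 F1 F2.
  have [r sr rE] := jump_poly F K1 K2 PQ.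
  have [a aE] : exists a, r = a *: legendre (p - 1).
    apply: legendre_moments (ltnW p1) sr _ => j jp.
    have := H F intF K1 K2 K12 F1 F2 j jp.
    have [c c0 ->] := jump_moment j PQ vQ K12 F1 F2 intF rE.
    by move=> /eqP; rewrite mulf_eq0 (negPf c0) => /eqP.
  by exists a => t; rewrite rE aE hornerZ.
move=> F intF K1 K2 K12 F1 F2 j jp.
have [a aE] := jQ F K1 K2 K12 F1 F2.
have rE t : Q K1 (edge_point ends F t) - Q K2 (edge_point ends F t) =
    (a *: legendre (p - 1)).[2 * t - 1] by rewrite aE hornerZ.
have [c _ ->] := jump_moment j PQ vQ K12 F1 F2 intF rE.
rewrite -scalerAl itgZ; case: (ltngtP j (p - 1)) => jp1.
- by rewrite [legendre (p - 1) * _]mulrC legendre_orthog ?mulr0 // size_legendre.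
- by rewrite legendre_orthog ?mulr0 // size_legendre; lia.
- by move: jp; rewrite jp1 => /orP[|/eqP]; lia.
Qed.

End Traces.

Theorem lemma2p2 (R : realType) (Omega : set (R * R)) (T : mesh R)
    (ends : {set node T} -> node T * node T) (nF : {set node T} -> R * R)
    (p : nat) :
  bounded_lipschitz_domain Omega ->
  @conforming_mesh R T Omega ->
  edge_orientation ends ->
  unit_edge_normals nF ->
  (0 < p)%N -> ~~ odd p ->
  V_im Omega ends nF p = V_ex Omega ends p.
Proof.
move=> [oO _ _ bO lipO] Tconf endsP nFP p0 p_even.
have p1 : (1 < p)%N by case: p p0 p_even => [|[]].
have nondeg := mesh_nondegenerate Tconf.
have cover := mesh_cover Tconf.
apply/seteqP; split=> v.
- move=> [[L2v _] polv mom].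
  have /choice[Q QP] := polv.
  have PQ (K : elt T) : poly_fun p (Q K) by have [] := QP K.
  have vQ (K : elt T) : ae_eq area_measure (triangle K) v (Q K) by have [] := QP K.
  have ncQ := (edge_moments_nonconforming Tconf endsP nFP p1 PQ vQ).1 mom.
  split=> //; exists (elementwise Q).
    exact: (nonconforming_span nondeg endsP p0 p_even ncQ).
  apply: (@ae_eq_restrict _ _ (closure Omega)); first exact: subset_closure.
  rewrite cover; apply: ae_eq_bigcup => K; apply/(ae_eq_triangle nondeg).
  apply: (@ae_trans _ _ _ (Q K)); first exact/(ae_eq_triangle nondeg).
  by apply: ae_eqW => x xK; rewrite (elementwise_interior Tconf _ xK).
- move=> [L2v [w /(span_nonconforming nondeg endsP p0 p_even)[Q ncQ ->] vw]].
  have [PQ _] := ncQ.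
  have KO (K : elt T) : (triangle K)° `<=` Omega.
    move=> x xK; apply: (interior_closure_lipschitz oO lipO).
    by apply: filterS xK => y yK; rewrite cover; exists K.
  have PQ' (K : elt T) : poly_fun p (Q K) by exact/poly_funE.
  have vQ (K : elt T) : ae_eq area_measure (triangle K)° v (Q K).
    apply: ae_trans (ae_eq_restrict (@KO K) vw) _.
    by apply: ae_eqW => x xK; exact: (elementwise_interior Tconf _ xK).
  have vQ' (K : elt T) : ae_eq area_measure (triangle K) v (Q K).
    exact/(ae_eq_triangle nondeg).
  split.
  + split=> // K; have [M [Mreal HM]] := bO.
    have bd z : (triangle K)° z -> `|z.1| < `|M| + 2 /\ `|z.2| < `|M| + 2.
      move=> /KO Oz; have : `|z| < `|M| + 2.
        apply: le_lt_trans (HM (`|M| + 1) _ _ Oz) _; last by rewrite ltrD2l ltr1n.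
        by rewrite (le_lt_trans (ler_norm M)) // ltrDl.
      have := @ball_normE R (R * R)%type; move=> bE zM.
      have : ball (0 : R * R) (`|M| + 2) z by rewrite -bE /ball_ /= sub0r normrN.
      by move=> []; rewrite /ball /= !sub0r !normrN.
    apply: (H1_of_poly (n := p.+1) _ bd _ (PQ K)) => //.
    * exact: open_interior.
    * by apply: (L2_restrict _ (@KO K) L2v); exact: open_interior.
  + by move=> K; exists (Q K).
  + exact: (edge_moments_nonconforming Tconf endsP nFP p1 PQ' vQ').2.
Qed.
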